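(* Let $R$ be a local ring of Krull dimension one with regular maximal ideal $M$. The following are equivalent: (1) $R$ is a Bass ring. (2) $R$ is a generalized local ring and $\overline{R}$ can be generated by two elements as an $R$-module. (3) $\overline{R}$ is a Noetherian ring that can be generated by two elements as an $R$-module.
   Context: All rings are commutative with identity; a local ring is a ring with a unique maximal ideal (not necessarily Noetherian). $Q(R)$ is the total ring of quotients and $\overline{R}$ the integral closure of $R$ in $Q(R)$. An ideal is regular if it contains a nonzerodivisor. A Bass ring is a reduced Noetherian local ring $R$ such that $\overline{R}$ is a finitely generated $R$-module and every ideal of $R$ can be generated by two elements. A generalized local ring is a local ring $(R,M)$ whose maximal ideal $M$ is finitely generated and satisfies $\bigcap_{i\ge1}M^i=0$. *)

(* Defs.v *)
From HB Require Import structures.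
From mathcomp Require Import all_boot all_order all_algebra.
Set Implicit Arguments. Unset Strict Implicit. Unset Printing Implicit Defensive.
Import Order.TTheory GRing.Theory Num.Theory.
Local Open Scope ring_scope.

Section CommAlg.
Variable A : comNzRingType.

Definition ideal_in (S I : A -> Prop) : Prop :=
  [/\ forall x, I x -> S x, I 0,
      forall x y, I x -> I y -> I (x + y)
    & forall s x, S s -> I x -> I (s * x)].

Definition generates_in (S I : A -> Prop) (g : seq A) : Prop :=
  (forall k, (k < size g)%N -> I g`_k) /\
  forall x, I x <-> exists c : seq A, size c = size g /\
      (forall k, (k < size c)%N -> S c`_k) /\
      x = \sum_(k < size g) c`_k * g`_k.

Definition noetherian_in (S : A -> Prop) : Prop :=
  forall I, ideal_in S I -> exists g : seq A, generates_in S I g.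

Definition ideal (I : A -> Prop) := ideal_in (fun _ => True) I.
Definition fg_ideal (I : A -> Prop) :=
  exists g : seq A, generates_in (fun _ => True) I g.
Definition noetherian := noetherian_in (fun _ => True).

Definition prime_ideal (P : A -> Prop) : Prop :=
  [/\ ideal P, ~ P 1 & forall a b, P (a * b) -> P a \/ P b].

Definition maximal_ideal (M : A -> Prop) : Prop :=
  [/\ ideal M, ~ M 1 &
      forall J, ideal J -> (forall x, M x -> J x) -> ~ J 1 ->
        forall x, J x -> M x].

Definition is_unique_maximal (M : A -> Prop) : Prop :=
  maximal_ideal M /\ forall N, maximal_ideal N -> forall x, N x <-> M x.

Definition local_ring : Prop := exists M, is_unique_maximal M.

Definition strict_incl (P P' : A -> Prop) : Prop :=
  (forall x, P x -> P' x) /\ exists x, P' x /\ ~ P x.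

Definition krull_dim_one : Prop :=
  (exists P0 P1, [/\ prime_ideal P0, prime_ideal P1 & strict_incl P0 P1]) /\
  ~ (exists P0 P1 P2, [/\ prime_ideal P0, prime_ideal P1, prime_ideal P2,
                          strict_incl P0 P1 & strict_incl P1 P2]).

Definition nonzerodivisor (s : A) : Prop := forall y, s * y = 0 -> y = 0.

Definition regular_ideal (I : A -> Prop) : Prop :=
  exists s, I s /\ nonzerodivisor s.

Definition reduced : Prop := forall (x : A) (n : nat), x ^+ n = 0 -> x = 0.

Fixpoint ideal_pow (M : A -> Prop) (i : nat) : A -> Prop :=
  match i with
  | 0 => fun _ => True
  | i'.+1 => fun x => exists a b : seq A, [/\ size a = size b,
        (forall k, (k < size a)%N -> M a`_k),
        (forall k, (k < size b)%N -> ideal_pow M i' b`_k) &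
        x = \sum_(k < size a) a`_k * b`_k]
  end.

Definition generalized_local (M : A -> Prop) : Prop :=
  [/\ is_unique_maximal M, fg_ideal M &
      forall x, (forall i, (1 <= i)%N -> ideal_pow M i x) -> x = 0].

End CommAlg.

Definition total_quotient (R : comNzRingType) (Q : comUnitRingType)
    (f : {rmorphism R -> Q}) : Prop :=
  [/\ forall s, nonzerodivisor s -> f s \is a GRing.unit,
      forall q, exists a s, nonzerodivisor s /\ q = f a / f s
    & forall a, f a = 0 -> exists s, nonzerodivisor s /\ s * a = 0].

Definition int_closure (R : comNzRingType) (Q : comUnitRingType)
    (f : {rmorphism R -> Q}) : Q -> Prop := fun q => integralOver f q.

Definition rmodule_generates (R : comNzRingType) (Q : comUnitRingType)
    (f : {rmorphism R -> Q}) (S : Q -> Prop) (g : seq Q) : Prop :=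
  (forall k, (k < size g)%N -> S g`_k) /\
  forall q, S q <-> exists c : seq R, size c = size g /\
      q = \sum_(k < size g) f c`_k * g`_k.

Definition rmodule_fg (R : comNzRingType) (Q : comUnitRingType) (f : {rmorphism R -> Q}) (S : Q -> Prop) : Prop :=
  exists g, rmodule_generates f S g.

Definition rmodule_2gen (R : comNzRingType) (Q : comUnitRingType) (f : {rmorphism R -> Q}) (S : Q -> Prop) : Prop :=
  exists g, (size g <= 2)%N /\ rmodule_generates f S g.

(* Bass ring (integral closure taken in Q(R), given by f) *)
Definition bass_ring (R : comNzRingType) (Q : comUnitRingType)
    (f : {rmorphism R -> Q}) : Prop :=
  [/\ reduced R, noetherian R, local_ring R,
      rmodule_fg f (int_closure f) &
      forall I : R -> Prop, ideal I ->
        exists g, (size g <= 2)%N /\ generates_in (fun _ => True) I g].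

(* Main.v *)
Require Import Defs.
From HB Require Import structures.
From mathcomp Require Import all_boot all_order all_algebra.
From mathcomp Require Import boolp classical_sets.
From mathcomp Require Import ring.
Set Implicit Arguments. Unset Strict Implicit. Unset Printing Implicit Defensive.
Import GRing.Theory.
Local Open Scope ring_scope.

(* Write O for the integral closure. If O is generated by two elements, then
   one of them may be taken to be 1, so O = R + R w with w quadratic over R.

   (3) => (2): for an ideal I of R, the set of r in I with r w in I is an ideal
   of O, and I is generated by it together with generators in I of I O. As O is
   Noetherian, I is finitely generated; so R is Noetherian, and the powers of M
   intersect in 0 because M^l lies in s^k R for a regular s in M.

   (2) => (1), (3): a nilpotent of R is divisible in R by every power of s,
   hence is 0. Then Q is von Neumann regular with at most four idempotents,
   since O/MO has dimension at most 2 and so O has no three pairwise comaximal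
   proper ideals. Up to an idempotent every ideal of R is regular, and Cohen's
   theorem shows that R is Noetherian. For q in Q let D = (O : q). Integral
   closedness forces D + qD = O, and as D, qD, (1+q)D are pairwise comaximal,
   one of them is O. Hence for a regular ideal I of R there is x in I with
   I O = x O. So I = x (R + L w) for an ideal L of R; applying the same to L,
   with generator y, gives I = (x, x y w).

   (1) => (2): t O is an ideal of R for some regular t, hence 2-generated. *)

(** * Submodules and their generators *)

Section Span.
Variable A : comNzRingType.
Implicit Types (C J S : A -> Prop) (g : seq A).

Definition subring C :=
  [/\ C 1, forall x y, C x -> C y -> C (x - y)
    & forall x y, C x -> C y -> C (x * y)].

Definition submod C J :=
  [/\ J 0, forall x y, J x -> J y -> J (x + y)
    & forall c x, C c -> J x -> J (c * x)].

(** Recursion on the list lets proofs about generators go by induction; [spanP] and [generates_inP]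
    translate to the indexed sums of [generates_in]. *)
Fixpoint span C g (x : A) : Prop :=
  if g is a :: g' then exists2 c, C c & span C g' (x - c * a) else x = 0.

Definition gens C J g :=
  (forall a, a \in g -> J a) /\ forall x, J x -> span C g x.

Lemma subring0 C : subring C -> C 0.
Proof. by case=> C1 CB _; rewrite -(subrr 1); apply: CB. Qed.

Lemma subringN C x : subring C -> C x -> C (- x).
Proof. by move=> CR Cx; rewrite -sub0r; have [_ + _] := CR; apply => //; apply: subring0. Qed.

Lemma subringD C x y : subring C -> C x -> C y -> C (x + y).
Proof.
move=> CR Cx Cy; rewrite -(opprK y); have [_ + _] := CR; apply => //.
exact: subringN.
Qed.

Lemma subring_true : subring (fun _ : A => True).
Proof. by []. Qed.

Lemma submodN C J x : subring C -> submod C J -> J x -> J (- x).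
Proof.
move=> CR [_ _ JM] Jx; rewrite -mulN1r; apply: JM => //.
by apply: subringN => //; case: CR.
Qed.

Lemma submodB C J x y : subring C -> submod C J -> J x -> J y -> J (x - y).
Proof.
move=> CR JS Jx Jy; have [_ JD _] := JS.
by apply: JD => //; apply: submodN JS Jy.
Qed.

Lemma ideal_in_submod C J : ideal_in C J -> submod C J.
Proof. by case. Qed.

Lemma span_submod C g : subring C -> submod C (span C g).
Proof.
move=> CR; have [C1 _ CM] := CR; elim: g => [|a g [s0 sD sM]] /=; split=> //.
- by move=> x y -> ->; rewrite addr0.
- by move=> c x _ ->; rewrite mulr0.
- by exists 0; [apply: subring0|rewrite mul0r subr0].
- move=> x y [c Cc sx] [d Cd sy]; exists (c + d); first exact: subringD.
  by have := sD _ _ sx sy; congr span; ring.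
- move=> d x Cd [c Cc sx]; exists (d * c); first exact: CM.
  by have := sM _ _ Cd sx; congr span; ring.
Qed.

Lemma span_mem C g a : subring C -> a \in g -> span C g a.
Proof.
move=> CR; have [C1 _ _] := CR; elim: g => [//|b g IH]; rewrite inE.
have [s0 _ _] := span_submod g CR.
case: (eqVneq a b) => [->|_] /=; first by exists 1 => //; rewrite mul1r subrr.
move=> /IH sa; exists 0; first exact: subring0.
by rewrite mul0r subr0.
Qed.

Lemma span_min C g J x :
  submod C J -> (forall a, a \in g -> J a) -> span C g x -> J x.
Proof.
move=> [J0 JD JM]; elim: g x => [|a g IH] x Jg /= => [->//|[c Cc sx]].
rewrite -(subrK (c * a) x); apply: JD.
  by apply: IH sx => b bg; apply: Jg; rewrite inE bg orbT.
by apply: JM => //; apply: Jg; rewrite mem_head.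
Qed.

Lemma span_sub C g g' x : subring C ->
  {subset g <= g'} -> span C g x -> span C g' x.
Proof.
move=> CR gg'; apply: span_min; first exact: span_submod.
by move=> a /gg'; apply: span_mem.
Qed.

Lemma spanP C g x : subring C ->
  span C g x <-> exists c, size c = size g /\
    (forall k, (k < size c)%N -> C c`_k) /\ x = \sum_(k < size g) c`_k * g`_k.
Proof.
move=> CR; elim: g x => [|a g IH] x /=; split.
- by move=> ->; exists [::]; rewrite big_ord0.
- by move=> [c [_ [_ ->]]]; rewrite big_ord0.
- move=> [d Cd /IH [c [sc [Cc e]]]]; exists (d :: c); split; first by rewrite /= sc.
  split; first by case.
  by rewrite big_ord_recl /=; rewrite -e addrC subrK.
- move=> [[|d c] [sc [Cc ->]]] //; case: sc => sc.
  exists d; first exact: (Cc 0%N).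
  apply/IH; exists c; split=> //; split; first by move=> k; apply: (Cc k.+1).
  by rewrite big_ord_recl /= addrAC subrr add0r.
Qed.

Lemma generates_inP C J g : subring C -> submod C J ->
  generates_in C J g <-> gens C J g.
Proof.
move=> CR JS; split=> [[Jg sp]|[Jg sp]]; split.
- by move=> a /(nthP 0) [k kg <-]; apply: Jg.
- by move=> x /sp; rewrite -(spanP g x CR).
- by move=> k kg; apply: Jg; apply: mem_nth.
- move=> x; rewrite -(spanP g x CR); split; first exact: sp.
  exact: span_min.
Qed.

End Span.

(** * Prime ideals from Zorn's lemma, and Cohen's theorem *)

Section Zorn.
Variable R : comNzRingType.
Let T (_ : R) := True.

Lemma ideal_zorn (Phi : set (set R)) (I : set R) : ideal I -> Phi I ->
  (forall F : set (set R), (F `<=` Phi)%classic -> total_on F subset -> (F !=set0)%classic ->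
     Phi (\bigcup_(X in F) X)%classic) ->
  exists P : set R, [/\ ideal P, Phi P, (I `<=` P)%classic &
    forall J : set R, ideal J -> (P `<=` J)%classic -> Phi J ->
      (J `<=` P)%classic].
Proof.
move=> idI PhiI chain.
pose G X := X = classical_sets.set0 \/ [/\ ideal X, Phi X & (I `<=` X)%classic].
have [F FG totF|P [GP maxP]] := @Zorn_bigcup R G.
  pose F' := (F `&` [set X | X <> classical_sets.set0])%classic.
  have [[X0 [FX0 X00]]|F'0] := EM (F' !=set0)%classic; last first.
    left; rewrite -subset0 => x [X FX Xx]; apply: F'0; exists X; split=> //.
    by move=> eX0; rewrite eX0 in Xx.
  have F'G X : F' X -> [/\ ideal X, Phi X & (I `<=` X)%classic].
    by move=> [/FG [->|//]].
  have -> : (\bigcup_(X in F) X = \bigcup_(X in F') X)%classic.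
    apply/seteqP; split=> x [X FX Xx]; exists X => //; last by case: FX.
    by split=> //= eX0; rewrite eX0 in Xx.
  have totF' : total_on F' subset by move=> X Y [FX _] [FY _]; apply: totF.
  have F'X0 : F' X0 by split.
  have [[_ X00' _ _] _ IX0] := F'G _ F'X0.
  right; split; last by move=> x /IX0 ?; exists X0.
    split=> //; first by exists X0.
      move=> x y [X FX Xx] [Y FY Yy].
      have [XY|YX] := totF' _ _ FX FY.
        by exists Y => //; case: (F'G _ FY) => -[_ _ + _] _ _; apply => //; apply: XY.
      by exists X => //; case: (F'G _ FX) => -[_ _ + _] _ _; apply => //; apply: YX.
    move=> s x _ [X FX Xx]; exists X => //.
    by case: (F'G _ FX) => -[_ _ _ +] _ _; apply.
  apply: chain => //; last by exists X0.
  by move=> X /F'G [].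
have [I0 _ _] : [/\ I 0, True & True] by case: idI.
case: GP => [P0|[idP PhiP IP]].
  exfalso; apply: (maxP I); last by right; split.
  rewrite P0; split; first exact: sub0set.
  by move=> /(_ _ I0).
exists P; split=> // J idJ PJ PhiJ; apply: contrapT => nJP.
apply: (maxP J); first by split.
by right; split=> // x /IP /PJ.
Qed.

Lemma ideal_adjoin (P : R -> Prop) a : ideal P ->
  ideal (fun x => exists p y, P p /\ x = p + a * y).
Proof.
move=> [_ P0 PD PM]; split=> //.
- by exists 0, 0; split=> //; ring.
- move=> _ _ [p [y [Pp ->]]] [p' [y' [Pp' ->]]].
  by exists (p + p'), (y + y'); split; [apply: PD|ring].
- move=> s _ _ [p [y [Pp ->]]]; exists (s * p), (s * y); split; last by ring.
  exact: PM.
Qed.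

(** If neither a nor b is in P, maximality makes P + aR and P + bR meet S; the product of the two
    elements found lies in S and, when ab is in P, also in P. Maximality stays in the conclusion for
    the sake of [ideal_sub_local]. *)
Lemma prime_avoiding (S I : R -> Prop) : S 1 ->
    (forall x y, S x -> S y -> S (x * y)) -> ideal I ->
    (forall x, S x -> ~ I x) ->
  exists P, [/\ prime_ideal P, forall x, I x -> P x, forall x, S x -> ~ P x &
    forall J, ideal J -> (forall x, P x -> J x) -> (forall x, S x -> ~ J x) ->
      forall x, J x -> P x].
Proof.
move=> S1 SM idI SI.
have [F FS _ _|P [idP SP IP maxP]] :=
  @ideal_zorn (fun X => forall x, S x -> ~ X x) I idI SI.
  by move=> x Sx [X /FS SX]; apply: SX.
exists P; split=> //; split=> //; first exact: SP.
move=> a b Pab; apply: contrapT => /not_orP [nPa nPb].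
have [_ P0 PD PM] := idP.
have key c : ~ P c -> exists2 x, S x & exists p y, P p /\ x = p + c * y.
  move=> nPc; apply: contrapT => no; apply: nPc.
  apply: (maxP _ (ideal_adjoin c idP)).
  - by move=> x Px; exists x, 0; split=> //; ring.
  - by move=> x Sx Jx; apply: no; exists x.
  - by exists 0, 1; split=> //; ring.
have [x Sx [p [y [Pp ex]]]] := key a nPa.
have [x' Sx' [p' [y' [Pp' ex']]]] := key b nPb.
apply: (SP _ (SM _ _ Sx Sx')).
have -> : x * x' = (p' + b * y') * p + (a * y) * p' + (y * y') * (a * b).
  by rewrite ex ex'; ring.
by apply: (PD); first apply: (PD); apply: (PM).
Qed.

(** Cohen's argument, with P maximal among the ideals that are not finitely generated. If ab is in P
    but a and b are not, then P + aR and (P : a) are strictly larger, hence finitely generated, and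
    P is generated by the P-components of generators of the first together with a times generators
    of the second. *)
Lemma max_nonfg_prime (I : R -> Prop) : ideal I -> (~ exists g, gens T I g) ->
  exists P, [/\ prime_ideal P, forall x, I x -> P x & ~ exists g, gens T P g].
Proof.
move=> idI nfgI.
have [F FS totF [X0 FX0] [g [Fg spg]]|P [idP nfgP IP maxP]] :=
  @ideal_zorn (fun X => ~ exists g, gens T X g) I idI nfgI.
  have [X FX Xg] : exists2 X, F X & forall a, a \in g -> X a.
    elim: g Fg {spg} => [|a g IH] Fg; first by exists X0.
    have [|X FX Xg] := IH; first by move=> b bg; apply: Fg; rewrite inE bg orbT.
    have [Y FY Ya] := Fg _ (mem_head a g).
    have [XY|YX] := totF _ _ FX FY.
      by exists Y => // b; rewrite inE => /predU1P [->//|/Xg /XY].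
    by exists X => // b; rewrite inE => /predU1P [->|/Xg //]; apply: YX.
  apply: (FS _ FX); exists g; split=> // x Xx.
  by apply: spg; exists X.
have fgP J : ideal J -> (forall x, P x -> J x) -> forall a, J a -> ~ P a ->
    exists g, gens T J g.
  move=> idJ PJ a Ja nPa; apply: contrapT => nfgJ; apply: nPa.
  exact: maxP _ idJ PJ nfgJ _ Ja.
have [_ P0 PD PM] := idP.
exists P; split=> //; split=> //.
  move=> P1; apply: nfgP; exists [:: 1]; split; first by move=> a; rewrite inE => /eqP ->.
  by move=> x _ /=; exists x => //; ring.
move=> a b Pab; apply: contrapT => /not_orP [nPa nPb]; apply: nfgP.
have [||g [Jg spg]] := fgP _ (ideal_adjoin a idP) _ a _ nPa.
- by move=> x Px; exists x, 0; split=> //; ring.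
- by exists 0, 1; split=> //; ring.
have [|||h [Ph sph]] := fgP (fun x => P (a * x)) _ _ b _ nPb.
- split=> //; first by rewrite mulr0.
    by move=> x y Px Py; rewrite mulrDr; apply: PD.
  by move=> s x _ Px; rewrite mulrCA; apply: PM.
- by move=> x; apply: PM.
- exact: Pab.
have [g' [Pg' eg]] : exists g', (forall c, c \in g' -> P c) /\
    forall x, span T g x -> exists p y, span T g' p /\ x = p + a * y.
  elim: g Jg {spg} => [|c g IH] Jg.
    exists [::]; split=> // x ->; exists 0, 0; split=> //; ring.
  have [|g' [Pg' eg]] := IH; first by move=> d dg; apply: Jg; rewrite inE dg orbT.
  have [p [y [Pp ec]]] := Jg _ (mem_head c g).
  exists (p :: g'); split; first by move=> d; rewrite inE => /predU1P [->//|/Pg'].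
  move=> x /= [d _ /eg [p' [y' [sp' ex]]]].
  exists (p' + d * p), (y' + d * y); split; last first.
    by rewrite -(subrK (d * c) x) ex ec; ring.
  by exists d => //; rewrite addrK.
exists (g' ++ [seq a * c | c <- h]); split.
  move=> c; rewrite mem_cat => /orP [/Pg' //|/mapP [d /Ph ? ->]//].
move=> x Px.
have /spg/eg [p [y [sp' ex]]] : exists p y, P p /\ x = p + a * y.
  by exists x, 0; split=> //; ring.
have [_ sD _] := @span_submod R T (g' ++ [seq a * c | c <- h]) (@subring_true R).
rewrite ex; apply: sD.
  by apply: span_sub sp' => // c; rewrite mem_cat => ->.
have Pp : P p by apply: (span_min (C := T)) sp'; first split.
have Pay : P (a * y).
  rewrite -[a * y](addKr p) -ex; apply: PD => //.
  by rewrite -mulN1r; apply: PM.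
apply: (span_sub (g := [seq a * c | c <- h])) => //.
  by move=> c; rewrite mem_cat orbC => ->.
move: (sph _ Pay); elim: h y {ex Ph sph Pay} => [|c h IH] y /=.
  by move=> ->; rewrite mulr0.
by move=> [d _ /IH sy]; exists d => //; move: sy; congr span; ring.
Qed.

End Zorn.

(** * Local rings of dimension one *)

Lemma prime_Xn (R : comNzRingType) (P : R -> Prop) a n :
  prime_ideal P -> P (a ^+ n) -> P a.
Proof.
by move=> [_ P1 PM]; elim: n => [/P1|n IH] //; rewrite exprS => /PM [].
Qed.

Section Local.
Variables (R : comNzRingType) (M : R -> Prop).
Hypothesis hM : is_unique_maximal M.
Let T (_ : R) := True.

Lemma local_ideal : ideal M.
Proof. by have [[]] := hM. Qed.

Lemma local_proper : ~ M 1.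
Proof. by have [[]] := hM. Qed.

(** With S = {1}, [prime_avoiding] yields an ideal maximal among the proper ones, which can only be
    M. *)
Lemma ideal_sub_local J : ideal J -> ~ J 1 -> forall x, J x -> M x.
Proof.
move=> idJ J1.
have [||||P [[idP P1 _] JP _ maxP]] := @prime_avoiding R (fun x => x = 1) J.
- by [].
- by move=> x y -> ->; rewrite mulr1.
- by [].
- by move=> x ->.
suff /(hM.2 P) PM : maximal_ideal P by move=> x /JP /PM.
split=> // K idK PK K1; apply: maxP => //.
by move=> x ->.
Qed.

Lemma local_unit x : ~ M x -> exists y, x * y = 1.
Proof.
move=> nMx; apply: contrapT => nu; apply: nMx.
apply: (@ideal_sub_local (fun z => exists y, z = x * y)); last first.
- by exists 1; rewrite mulr1.
- by move=> [y e]; apply: nu; exists y.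
split=> //; first by exists 0; rewrite mulr0.
  by move=> _ _ [y ->] [z ->]; exists (y + z); rewrite mulrDr.
by move=> s _ _ [y ->]; exists (s * y); rewrite mulrCA.
Qed.

Lemma local_1B m : M m -> exists y, (1 - m) * y = 1.
Proof.
move=> Mm; apply: local_unit => M1m; apply: local_proper.
by have [_ _ MD _] := local_ideal; rewrite -(subrK m 1); apply: MD.
Qed.

Lemma local_prime : prime_ideal M.
Proof.
split; [exact: local_ideal|exact: local_proper|move=> a b Mab].
 have [|/local_unit [y ay]] := EM (M a); first by left.
right; have [_ _ _ MM] := local_ideal.
have -> : b = y * (a * b) by rewrite mulrA (mulrC y) ay mul1r.
exact: MM.
Qed.

(* This is the elementwise form of dimension at most one: every boundary
   ideal is trivial. *)
Lemma dim_one_boundary a b : krull_dim_one R -> M a -> M b ->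
  exists n m x, a ^+ n * (b ^+ m - a * x) = 0.
Proof.
move=> [_ hdim] Ma Mb; apply: contrapT => no; apply: hdim.
(* If 0 is not in this multiplicative set, some prime P avoids it. Then P + aR contains no power of
   b, and a prime P' above it that avoids these powers gives a chain P < P' < M, separated by a and
   b. *)
pose S z := exists n m x, z = a ^+ n * (b ^+ m - a * x).
have [||||P [prP _ SP _]] := @prime_avoiding R S (fun x => x = 0).
- by exists 0%N, 0%N, 0; ring.
- move=> _ _ [n [m [x ->]]] [n' [m' [x' ->]]].
  exists (n + n')%N, (m + m')%N, (b ^+ m * x' + x * (b ^+ m' - a * x')).
  by rewrite !exprD; ring.
- by split=> // [x y -> ->|s x _ ->]; rewrite ?addr0 ?mulr0.
- by move=> _ [n [m [x ->]]] e; apply: no; exists n, m, x.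
have [idP P1 _] := prP.
have [||||P' [prP' PP' SP' _]] := @prime_avoiding R (fun z => exists m, z = b ^+ m)
    (fun x => exists p y, P p /\ x = p + a * y).
- by exists 0%N; rewrite expr0.
- by move=> _ _ [m ->] [m' ->]; exists (m + m')%N; rewrite exprD.
- exact: ideal_adjoin.
- move=> _ [m ->] [p [y [Pp e]]]; apply: (SP p) => //.
  by exists 0%N, m, y; rewrite expr0 e; ring.
have [idP' P'1 _] := prP'.
exists P, P', M; split=> //.
- exact: local_prime.
- split; first by move=> x Px; apply: PP'; exists x, 0; split=> //; ring.
  exists a; split.
    by apply: PP'; exists 0, 1; split; [case: idP|ring].
  by apply: SP; exists 1%N, 0%N, 0; ring.
- split; first exact: ideal_sub_local.
  by exists b; split=> //; apply: SP'; exists 1%N; rewrite expr1.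
Qed.

(** Treating the generators one after another, multiply x by the largest power of a that keeps it
    outside E. Closure of E under multiples preserves what was reached for the earlier
    generators. *)
Lemma socle (E : R -> Prop) (g : seq R) : (forall r x, E x -> E (r * x)) ->
  (forall a, a \in g -> exists n, E (a ^+ n)) -> ~ E 1 ->
  exists x, ~ E x /\ forall a, a \in g -> E (a * x).
Proof.
move=> Emul; elim: g => [|a g IH] Eg E1; first by exists 1.
have [|x [nEx Ex]] := IH _ E1.
  by move=> b bg; apply: Eg; rewrite inE bg orbT.
have [n] := Eg _ (mem_head a g).
move=> /(Emul x); rewrite mulrC; elim: n => [|n IHn]; first by rewrite mul1r.
have [/IHn //|nE] := EM (E (a ^+ n * x)); move=> E'.
exists (a ^+ n * x); split=> // b; rewrite inE => /predU1P [->|/Ex Ebx].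
  by rewrite mulrA -exprS.
by rewrite mulrCA; apply: Emul.
Qed.

(** Let E be the set of x that carry all high powers of M into A. If 1 were not in E, [socle] would
    give x outside E with a x in E for every generator a of M; but then x carries the powers from
    some M^(l+1) on into A. *)
Lemma ideal_pow_sub (A : R -> Prop) g : gens T M g -> ideal A ->
    (forall m, M m -> exists n, A (m ^+ n)) ->
  exists l, forall x, ideal_pow M l x -> A x.
Proof.
move=> [Mg spg] idA nilM; have [_ A0 AD AM] := idA.
pose E x := exists l, forall l' y, (l <= l')%N -> ideal_pow M l' y -> A (x * y).
suff [l El] : E 1 by exists l => x /El; rewrite mul1r; apply.
apply: contrapT => nE1.
have [||x [nEx Ex]] := @socle E g _ _ nE1.
- by move=> r x [l El]; exists l => l' y ll' /(El _ _ ll'); rewrite -mulrA; apply: AM.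
- move=> a /Mg /nilM [n An]; exists n, 0%N => l' y _ _.
  by rewrite mulrC; apply: AM.
apply: nEx.
have [l El] : exists l, forall a, a \in g -> forall l' y, (l <= l')%N ->
    ideal_pow M l' y -> A (a * x * y).
  elim: g {Mg spg} Ex => [|a g IH] Ex; first by exists 0%N.
  have [|l Hl] := IH; first by move=> b bg; apply: Ex; rewrite inE bg orbT.
  have [k Hk] := Ex _ (mem_head a g).
  exists (maxn k l) => b; rewrite inE => bg l' y; rewrite geq_max => /andP [kl' ll'].
  by case/predU1P: bg => [->|/Hl Hb]; [apply: Hk|apply: Hb].
exists l.+1 => -[//|l'] _ ll' [a [b [sab Ma Mb ->]]].
rewrite mulr_sumr; elim/big_ind: _ => // i _.
have Mbi : ideal_pow M l' b`_i by apply: Mb; rewrite -sab.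
have /spg : M a`_i by exact: Ma.
rewrite mulrCA mulrA; set c := a`_i; set d := b`_i in Mbi *.
apply: (span_min (J := fun c => A (c * x * d))) => [|c' cg]; last exact: El cg _ _ ll' Mbi.
by split=> [|u v|u v _]; rewrite ?mul0r // ?mulrDl; [apply: AD|rewrite -!mulrA; apply: AM].
Qed.

Lemma ideal_pow_ideal l : ideal (ideal_pow M l).
Proof.
elim: l => [//|l [_ P0 PD PM]]; split=> //=.
- by exists [::], [::]; split=> //; rewrite big_ord0.
- move=> _ _ [a [b [sab Ma Mb ->]]] [a' [b' [sab' Ma' Mb' ->]]].
  exists (a ++ a'), (b ++ b'); split; rewrite ?size_cat ?sab ?sab' //.
  + move=> k kl; rewrite nth_cat; case: ltnP => ?; first exact: Ma.
    by apply: Ma'; rewrite ltn_subLR // sab sab'.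
  + move=> k kl; rewrite nth_cat; case: ltnP => ?; first exact: Mb.
    by apply: Mb'; rewrite ltn_subLR.
  + rewrite big_split_ord /=; congr (_ + _).
      by apply: eq_bigr => i _; rewrite !nth_cat sab ltn_ord.
    by apply: eq_bigr => i _; rewrite !nth_cat sab !ltnNge !leq_addr /= !addKn.
- move=> s _ _ [a [b [sab Ma Mb ->]]].
  exists [seq s * c | c <- a], b; split; rewrite ?size_map //.
    by move=> k ka; rewrite (nth_map 0) //; have [_ _ _] := local_ideal; apply => //; apply: Ma.
  rewrite mulr_sumr; apply: eq_bigr => i _.
  by rewrite (nth_map 0) // mulrA.
Qed.

Lemma ideal_powX m l : M m -> ideal_pow M l (m ^+ l).
Proof.
move=> Mm; elim: l => [//|l IH] /=; exists [:: m], [:: m ^+ l].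
by split=> // [[]|[]|] //; rewrite big_ord_recl big_ord0 addr0 exprS.
Qed.

End Local.

(** * Total quotient rings and integral closure *)

Lemma noetherian_gens (R : comNzRingType) : noetherian R <->
  forall I : R -> Prop, ideal I -> exists g, gens (fun _ => True) I g.
Proof.
by split=> noeth I idI; have [g Ig] := noeth I idI; exists g;
  apply/(generates_inP g (@subring_true R) (ideal_in_submod idI)).
Qed.

Lemma noetherian_chain (R : comNzRingType) (J : nat -> R -> Prop) :
    noetherian R -> (forall k, ideal (J k)) ->
    (forall k l x, (k <= l)%N -> J k x -> J l x) ->
  exists N, forall k x, J k x -> J N x.
Proof.
move=> /noetherian_gens noeth idJ leJ.
have [|g [Jg spg]] := noeth (fun x => exists k, J k x).
  split=> //; first by exists 0%N; case: (idJ 0%N).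
    move=> x y [k Jx] [l Jy]; exists (maxn k l); have [_ _ JD _] := idJ (maxn k l).
    by apply: JD; [apply: leJ Jx|apply: leJ Jy]; rewrite ?leq_maxl ?leq_maxr.
  by move=> s x _ [k Jx]; exists k; have [_ _ _ JM] := idJ k; apply: JM.
have [N JN] : exists N, forall a, a \in g -> J N a.
  elim: g Jg {spg} => [|a g IH] Jg; first by exists 0%N.
  have [|N JN] := IH; first by move=> b bg; apply: Jg; rewrite inE bg orbT.
  have [k Jk] := Jg _ (mem_head a g).
  exists (maxn k N) => b; rewrite inE => /predU1P [->|/JN].
    by apply: leJ Jk; rewrite leq_maxl.
  by apply: leJ; rewrite leq_maxr.
exists N => k x Jx; have /spg : exists k, J k x by exists k.
by apply: span_min JN; exact: ideal_in_submod (idJ N).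
Qed.

Lemma nonzerodivisorM (R : comNzRingType) (s t : R) :
  nonzerodivisor s -> nonzerodivisor t -> nonzerodivisor (s * t).
Proof. by move=> hs ht y; rewrite -mulrA => /hs /ht. Qed.

Lemma nonzerodivisorX (R : comNzRingType) (s : R) n :
  nonzerodivisor s -> nonzerodivisor (s ^+ n).
Proof.
move=> hs; elim: n => [|n IH]; first by move=> y; rewrite mul1r.
by rewrite exprS; apply: nonzerodivisorM.
Qed.

Lemma nonzerodivisorI (R : comNzRingType) (s : R) :
  nonzerodivisor s -> injective ( *%R s).
Proof.
move=> rs x y /eqP; rewrite -subr_eq0 -mulrBr => /eqP /rs /eqP.
by rewrite subr_eq0 => /eqP.
Qed.

(** Put y_k = x / s^k, unique as s is regular. The ideals R y_k increase, so y_(N+1) = c y_N = c s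
    y_(N+1) for some N and c, and the unit 1 - c s forces y_(N+1) = 0. *)
Lemma separated_powers (R : comNzRingType) (M : R -> Prop) s x :
    is_unique_maximal M -> noetherian R -> M s -> nonzerodivisor s ->
  (forall k, exists y, x = s ^+ k * y) -> x = 0.
Proof.
move=> hM noeth Ms rs xs.
pose J k r := exists y c, x = s ^+ k * y /\ r = c * y.
have [|k l _ kl [y [c [ex ->]]]|N JN] := @noetherian_chain R J noeth.
- move=> k; have [y0 ey0] := xs k.
  have uniq y : x = s ^+ k * y -> y = y0.
    by move=> ey; apply: (nonzerodivisorI (nonzerodivisorX (n := k) rs)); rewrite -ey.
  split=> //.
  + by exists y0, 0; split=> //; ring.
  + move=> _ _ [y [c [ey ->]]] [z [d [ez ->]]]; exists y0, (c + d); split=> //.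
    by rewrite (uniq _ ey) (uniq _ ez); ring.
  + by move=> r _ _ [y [c [ey ->]]]; exists y, (r * c); rewrite mulrA.
- have [z ez] := xs l; exists z, (c * s ^+ (l - k)); split=> //.
  rewrite -mulrA; congr (_ * _); apply: (nonzerodivisorI (nonzerodivisorX (n := k) rs)).
  by rewrite mulrA -exprD subnKC // -ex.
have [y ey] := xs N.+1.
have [z [c [ez eyz]]] : J N y.
  by apply: (JN N.+1); exists y, 1; rewrite mul1r.
have zsy : z = s * y.
  by apply: (nonzerodivisorI (nonzerodivisorX (n := N) rs)); rewrite mulrA -exprSr -ey.
have [|u eu] := local_1B hM (m := c * s).
  by have [_ _ _ MM] := local_ideal hM; apply: MM.
have y0 : y = 0.
  rewrite -(mul1r y) -eu.
  have -> : (1 - c * s) * u * y = u * (y - c * (s * y)) by ring.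
  by rewrite -zsy -eyz subrr mulr0.
by rewrite ey y0 mulr0.
Qed.

Section TotalQuotient.
Variables (R : comNzRingType) (Q : comUnitRingType) (f : {rmorphism R -> Q}).
Hypothesis hQ : total_quotient f.
Let T (_ : R) := True.
Let O := int_closure f.

Definition frange (q : Q) := exists r, q = f r.

Lemma frange_subring : subring frange.
Proof.
split; first by exists 1; rewrite rmorph1.
  by move=> _ _ [a ->] [b ->]; exists (a - b); rewrite rmorphB.
by move=> _ _ [a ->] [b ->]; exists (a * b); rewrite rmorphM.
Qed.

Lemma tq_inj : injective f.
Proof.
move=> a b eab; have [_ _ /(_ (a - b))] := hQ.
rewrite rmorphB eab subrr => /(_ erefl) [s [rs /rs]].
by move/eqP; rewrite subr_eq0 => /eqP.
Qed.

Lemma tq_unit t : nonzerodivisor t -> f t \is a GRing.unit.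
Proof. by case: hQ => + _ _; apply. Qed.

Lemma tq_regular t : f t \is a GRing.unit -> nonzerodivisor t.
Proof.
move=> ut y ty; apply: tq_inj; apply: (mulrI ut).
by rewrite -rmorphM ty rmorph0 mulr0.
Qed.

Lemma tq_denom q : exists a t, nonzerodivisor t /\ f t * q = f a.
Proof.
have [_ /(_ q) [a [t [rt ->]]] _] := hQ.
by exists a, t; split=> //; rewrite mulrC divrK // tq_unit.
Qed.

Lemma int_closure_subring : subring O.
Proof.
split; first exact: integral1.
  by move=> x y; apply: integral_sub.
by move=> x y; apply: integral_mul.
Qed.

Lemma int_closure_f r : O (f r).
Proof. exact: integral_id. Qed.

Lemma submod_frange J : submod O J -> submod frange J.
Proof.
by move=> [J0 JD JM]; split=> // _ x [r ->]; apply: JM; apply: int_closure_f.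
Qed.

Lemma int_closure_submod : submod frange O.
Proof.
apply: submod_frange; have OR := int_closure_subring; have [_ _ OM] := OR.
by split; [exact: subring0|move=> x y; exact: subringD|].
Qed.

Lemma rmodule_generatesP J g : submod frange J ->
  rmodule_generates f J g <-> gens frange J g.
Proof.
move=> JS; rewrite -(generates_inP g frange_subring JS).
have coef x : (exists c : seq R, size c = size g /\
      x = \sum_(k < size g) f c`_k * g`_k) <->
    exists c : seq Q, size c = size g /\
      (forall k, (k < size c)%N -> frange c`_k) /\
      x = \sum_(k < size g) c`_k * g`_k.
  split=> [[c [sc ->]]|[c [sc [fc ->]]]].
    exists [seq f a | a <- c]; rewrite size_map; split=> //; split.
      by move=> k kc; exists c`_k; rewrite (nth_map 0).
    by apply: eq_bigr => k _; rewrite (nth_map 0) ?sc.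
  have [c' ec'] : exists c' : seq R, c = [seq f a | a <- c'].
    elim: c fc {sc} => [|a c IH] fc; first by exists [::].
    have [|c' ->] := IH; first by move=> k; apply: (fc k.+1).
    by have [r /= ->] := fc 0%N isT; exists (r :: c').
  move: sc; rewrite ec' size_map => sc; exists c'; split=> //.
  by apply: eq_bigr => k _; rewrite (nth_map 0) ?sc.
by split=> -[Jg sp]; split=> // x; rewrite sp; [|symmetry]; apply: coef.
Qed.

Lemma span_map g u r : span T g r -> span frange [seq f a * u | a <- g] (f r * u).
Proof.
elim: g r => [|a g IH] r /=; first by move=> ->; rewrite rmorph0 mul0r.
move=> [c _ /IH]; exists (f c); first by exists c.
by rewrite mulrA -rmorphM -mulrBl -rmorphB.
Qed.

Lemma fractional_ideal J t : submod frange J -> ideal (fun r => J (f r * t)).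
Proof.
move=> [J0 JD JM]; split=> //.
- by rewrite rmorph0 mul0r.
- by move=> x y Jx Jy; rewrite rmorphD mulrDl; apply: JD.
- by move=> s x _ Jx; rewrite rmorphM -mulrA; apply: JM => //; exists s.
Qed.

(** The ideal [fun r => J (f r / f t)] is t J viewed inside R, so its generators only have to be
    divided by t. *)
Lemma fractional_gens J t g : nonzerodivisor t ->
    (forall q, J q -> frange (f t * q)) ->
    gens T (fun r => J (f r / f t)) g ->
  gens frange J [seq f a / f t | a <- g].
Proof.
move=> rt tJ [Jg spg]; split; first by move=> _ /mapP [a ag ->]; apply: Jg.
move=> q Jq; have [r er] := tJ q Jq.
have eq : q = f r / f t by rewrite -er mulrC mulrA mulVr ?mul1r // tq_unit.
by rewrite eq; apply: span_map; apply: spg; rewrite -eq.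
Qed.

Lemma common_denom (g : seq Q) :
  exists t, nonzerodivisor t /\ forall q, span frange g q -> frange (f t * q).
Proof.
elim: g => [|a g [t [rt Ht]]].
  by exists 1; split=> [y|q ->]; [rewrite mul1r|exists 0; rewrite mulr0 rmorph0].
have [b [t' [rt' et']]] := tq_denom a.
exists (t * t'); split; first exact: nonzerodivisorM.
move=> q [_ [c ->] /Ht [r er]]; exists (t' * r + t * c * b).
rewrite rmorphD !rmorphM -er -et'; ring.
Qed.

Lemma nilpotent_int_closure q n : q ^+ n = 0 -> O q.
Proof.
move=> qn; exists 'X^n; first exact: monicXn.
by rewrite map_polyXn /root hornerXn qn.
Qed.

Lemma idempotent_int_closure e : e * e = e -> O e.
Proof.
move=> ee; exists ('X^2 - 'X).
  by rewrite monicE lead_coefDl ?lead_coefXn // size_polyXn size_polyN size_polyX.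
by rewrite rmorphB /= map_polyXn map_polyX /root !hornerE expr2 ee subrr.
Qed.

(* Noetherian substitute for the determinant trick: the fractional ideals
   spanned by 1, y, ..., y^k stabilise. *)
Lemma almost_integral d y : noetherian R -> nonzerodivisor d ->
  (forall k, frange (f d * y ^+ k)) -> O y.
Proof.
move=> noeth rd dy.
pose J k r := exists p : {poly R}, (size p <= k)%N /\ f r = f d * (map_poly f p).[y].
have [|k l r kl [p [sp er]]|N JN] := noetherian_chain noeth (J := J).
- move=> k; split=> //.
  + by exists 0; rewrite size_poly0 !rmorph0 horner0 mulr0.
  + move=> r r' [p [sp er]] [p' [sp' er']]; exists (p + p'); split.
      by apply: leq_trans (size_polyD _ _) _; rewrite geq_max sp.
    by rewrite !rmorphD hornerD er er' mulrDr.
  + move=> s r _ [p [sp er]]; exists (s *: p); split.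
      exact: leq_trans (size_scale_leq _ _) sp.
    by rewrite rmorphM er map_polyZ hornerZ mulrCA.
- by exists p; split=> //; apply: leq_trans kl.
have [r er] := dy N.
have [p [sp ep]] : J N r.
  apply: (JN N.+1); exists 'X^N; rewrite size_polyXn; split=> //.
  by rewrite map_polyXn hornerXn er.
(* Here d y^N = d p(y) with p of degree below N; cancelling d shows that this monic polynomial kills
   y. *)
exists ('X^N - p); last first.
  rewrite rmorphB /= map_polyXn /root hornerD hornerN hornerXn subr_eq0.
  by apply/eqP/(mulrI (tq_unit rd)); rewrite er ep.
by rewrite monicE lead_coefDl ?lead_coefXn // size_polyXn size_polyN ltnS.
Qed.

End TotalQuotient.

(** * Integral closures generated by two elements *)

Section TwoGenerated.
Variables (R : comNzRingType) (Q : comUnitRingType) (f : {rmorphism R -> Q}).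
Variable M : R -> Prop.
Hypotheses (hQ : total_quotient f) (hM : is_unique_maximal M).
Let O := int_closure f.

(** Write O = Ra + Rb and 1 = x a + y b. If x or y is a unit, 1 can replace the corresponding
    generator. If both are in M, multiplication by x a + y b = 1 acts on (a, b) through a matrix
    with entries in M, and Nakayama's determinant argument gives a = b = 0. *)
Lemma int_closure_basis : rmodule_2gen f O ->
  exists w, O w /\ forall q, O q -> exists c d, q = f c + f d * w.
Proof.
have [_ _ MD MM] := local_ideal hM.
have OR := int_closure_subring f; have [O1 _ OM] := OR.
have OS := int_closure_submod f; have [O0 _ OZ] := OS.
move=> [g [sg /(rmodule_generatesP g OS) [Og spg]]].
have {spg sg Og} [a [b [Oa Ob ab]]] : exists a b, [/\ O a, O b &
    forall q, O q -> exists c d, q = f c * a + f d * b].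
  case: g sg Og spg => [|a [|b [|//]]] _ Og spg.
  - by exists 0, 0; split=> // q /spg /= ->; exists 0, 0; rewrite rmorph0; ring.
  - exists a, 0; split=> // [|q /spg /= [_ [c ->] e]]; first by apply: Og; rewrite mem_head.
    by exists c, 0; move: e => /eqP; rewrite subr_eq0 => /eqP ->; ring.
  - exists a, b; split; rewrite ?Og ?inE ?eqxx ?orbT //.
      by apply: Og; rewrite !inE eqxx.
      by apply: Og; rewrite !inE eqxx orbT.
    move=> q /spg /= [_ [c ->] [_ [d ->] e]].
    by exists c, d; move: e => /eqP; rewrite subr_eq0 => /eqP <-; ring.
have [x [y e1]] := ab _ O1.
have sol u v x' y' : O v -> 1 = f x' * u + f y' * v -> ~ M x' ->
    (forall q, O q -> exists c d, q = f c * u + f d * v) ->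
    exists w, O w /\ forall q, O q -> exists c d, q = f c + f d * w.
  move=> Ov e /(local_unit hM) [z xz] uv; exists v; split=> // q /uv [c [d ->]].
  exists (c * z), (d - c * z * y').
  have fxz : f x' * f z = 1 by rewrite -rmorphM xz rmorph1.
  have -> : f c * u = f c * (f x' * f z) * u by rewrite fxz mulr1.
  have -> : f c * (f x' * f z) * u = f c * f z * (1 - f y' * v) by rewrite e; ring.
  by rewrite rmorphB !rmorphM; ring.
have [Mx|nMx] := EM (M x); last exact: sol e1 nMx ab.
have [My|nMy] := EM (M y); last first.
  apply: (sol b a y x) => //; first by rewrite addrC.
  by move=> q /ab [c [d ->]]; exists d, c; rewrite addrC.
exfalso.
have [p [q eaa]] := ab _ (OM _ _ Oa Oa).
have [p' [q' eab]] := ab _ (OM _ _ Oa Ob).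
have [p'' [q'' ebb]] := ab _ (OM _ _ Ob Ob).
pose m11 := x * p + y * p'; pose m12 := x * q + y * q'.
pose m21 := x * p' + y * p''; pose m22 := x * q' + y * q''.
have ea : a = f m11 * a + f m12 * b.
  rewrite -[LHS]mul1r e1 /m11 /m12 !rmorphD !rmorphM.
  transitivity (f x * (a * a) + f y * (a * b)); first by ring.
  by rewrite eaa eab; ring.
have eb : b = f m21 * a + f m22 * b.
  rewrite -[LHS]mul1r e1 /m21 /m22 !rmorphD !rmorphM.
  transitivity (f x * (a * b) + f y * (b * b)); first by ring.
  by rewrite ebb eab; ring.
have Mxy u v : M (x * u + y * v) by apply: MD; rewrite mulrC; apply: MM.
have [Mm11 Mm12] : M m11 /\ M m12 by split; apply: Mxy.
have [Mm21 Mm22] : M m21 /\ M m22 by split; apply: Mxy.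
clearbody m11 m12 m21 m22.
(* 1 - d is the determinant of the identity minus the matrix m; below, [a0] and [b0] multiply by the
   adjugate. *)
pose d := m11 + m22 - m11 * m22 + m12 * m21.
have Md : M d.
  have -> : d = m11 + (1 - m11) * m22 + m12 * m21 by rewrite /d; ring.
  apply: (MD); last exact: MM.
  by apply: (MD) => //; apply: MM.
have [z dz] := local_1B hM Md.
have det u : (1 - f d) * u = 0 -> u = 0.
  move=> du; rewrite -(mul1r u) -(rmorph1 f) -dz rmorphM rmorphB rmorph1.
  have -> : (1 - f d) * f z * u = f z * ((1 - f d) * u) by ring.
  by rewrite du mulr0.
have fd : f d = f m11 + f m22 - f m11 * f m22 + f m12 * f m21.
  by rewrite /d; ring.
have a0 : a = 0.
  apply: det; rewrite fd.
  transitivity ((1 - f m22) * (a - (f m11 * a + f m12 * b))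
     + f m12 * (b - (f m21 * a + f m22 * b))); first by ring.
  by rewrite -ea -eb !subrr !mulr0 addr0.
have b0 : b = 0.
  apply: det; rewrite fd.
  transitivity ((1 - f m11) * (b - (f m21 * a + f m22 * b))
     + f m21 * (a - (f m11 * a + f m12 * b))); first by ring.
  by rewrite -ea -eb !subrr !mulr0 addr0.
by move/eqP: e1; rewrite a0 b0 !mulr0 addr0 oner_eq0.
Qed.

Variable w : Q.
Hypotheses (Ow : O w) (hw : forall q, O q -> exists c d, q = f c + f d * w).

(* Since O = R + R w, this is the extension I O of an ideal I of R. *)
Definition ext (I : R -> Prop) x := exists a b, [/\ I a, I b & x = f a + f b * w].

Let idM := local_ideal hM.
Let OR := int_closure_subring f.
Let Of r : O (f r) := int_closure_f f r.
#[local] Hint Resolve Of : core.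

Lemma basis_mem c d : O (f c + f d * w).
Proof.
have [_ _ OM] := OR.
by apply: (subringD OR (Of _)); apply: (OM) (Of _) Ow.
Qed.

Lemma basis_sqr : exists alpha beta, w * w = f alpha + f beta * w.
Proof. by apply: hw; have [_ _ OM] := OR; apply: (OM). Qed.

Lemma ext_f I a : ideal I -> I a -> ext I (f a).
Proof.
by move=> [_ I0 _ _] Ia; exists a, 0; split=> //; rewrite rmorph0; ring.
Qed.

Lemma ext_mul I a x : ideal I -> I a -> O x -> ext I (f a * x).
Proof.
move=> [_ _ _ IM] Ia /hw [c [d ->]].
by exists (c * a), (d * a); split; try exact: IM; rewrite !rmorphM; ring.
Qed.

Lemma ext_ideal I : ideal I -> ideal_in O (ext I).
Proof.
move=> idI; have [_ I0 ID IM] := idI; have [_ _ OM] := OR.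
have D x y : ext I x -> ext I y -> ext I (x + y).
  move=> [a [b [Ia Ib ->]]] [c [d [Ic Id ->]]].
  by exists (a + c), (b + d); split; try exact: ID; rewrite !rmorphD; ring.
split=> //.
- by move=> _ [a [b [_ _ ->]]]; apply: basis_mem.
- by exists 0, 0; split=> //; rewrite rmorph0; ring.
- move=> x _ Ox [a [b [Ia Ib ->]]].
  have -> : x * (f a + f b * w) = f a * x + f b * (x * w) by ring.
  by apply: D; apply: ext_mul => //; apply: OM.
Qed.

Let MO := ext M.
Let MO_ideal : ideal_in O MO := ext_ideal idM.

(* The inverse comes from the norm of 1 - y, which lies in 1 + M. *)
Lemma ext_unit y : MO y -> exists z, O z /\ z * (1 - y) = 1.
Proof.
move=> [m [m' [Mm Mm' ->]]]; have [_ _ MD MM] := idM.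
have [alpha [beta ew]] := basis_sqr.
pose d := (m + m) - m * m + (1 - m) * m' * beta + m' * m' * alpha.
have Md : M d.
  have -> : d = (1 + (1 - m)) * m + ((1 - m) * beta + m' * alpha) * m'.
    by rewrite /d; ring.
  by apply: MD; apply: MM.
have [z dz] := local_1B hM Md.
(* [beta - w] is the conjugate of [w], so this is the conjugate of 1 - y divided by the norm 1 -
   d. *)
exists (f z * (1 - f m - f m' * (f beta - w))); split.
  have -> : f z * (1 - f m - f m' * (f beta - w)) =
      f (z * (1 - m - m' * beta)) + f (z * m') * w.
    by rewrite !(rmorphM, rmorphB, rmorph1); ring.
  exact: basis_mem.
rewrite -[RHS](rmorph1 f) -dz /d !(rmorphM, rmorphB, rmorphD, rmorph1).
transitivity (f z * ((1 - f m) * (1 - f m) - (1 - f m) * f m' * f beta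
    + f m' * f m' * (f beta * w - w * w))); first by ring.
rewrite ew; ring.
Qed.

Lemma add_ext A : ideal_in O A -> ideal_in O (fun x => exists a y, [/\ A a, MO y & x = a + y]).
Proof.
move=> [AO A0 AD AM]; have [MOO MO0 MOD MOM] := MO_ideal; split.
- by move=> _ [a [y [/AO Aa /MOO My ->]]]; apply: subringD OR Aa My.
- by exists 0, 0; split=> //; ring.
- move=> _ _ [a [y [Aa My ->]]] [a' [y' [Aa' My' ->]]].
  by exists (a + a'), (y + y'); split; [apply: AD|apply: MOD|ring].
- move=> s _ Os [a [y [Aa My ->]]].
  by exists (s * a), (s * y); split; [apply: AM|apply: MOM|ring].
Qed.

(** MO lies in the Jacobson radical of O: from 1 = a + y, the element a = 1 - y is a unit by
    [ext_unit]. *)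
Lemma add_ext_proper A : ideal_in O A -> ~ A 1 ->
  ~ exists a y, [/\ A a, MO y & 1 = a + y].
Proof.
move=> [_ _ _ AM] A1 [a [y [Aa My e]]]; apply: A1.
have [z [Oz <-]] := ext_unit My.
by rewrite e addrK; apply: AM.
Qed.

Lemma proper_contract G r : ideal_in O G -> ~ G 1 -> G (f r) -> M r.
Proof.
move=> [_ _ _ GM] G1 Gr; apply: contrapT => /(local_unit hM) [z rz]; apply: G1.
by rewrite -(rmorph1 f) -rz rmorphM mulrC; apply: GM.
Qed.

(** Modulo MO, the ring O is spanned over the residue field by 1 and w. An element c + d w of G
    outside MO has d a unit, since otherwise c would lie in G and hence in M; dividing by d makes it
    monic in w. *)
Lemma properE G : ideal_in O G -> (forall x, MO x -> G x) -> ~ G 1 ->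
  (forall x, G x -> MO x) \/ exists c, G (w - f c).
Proof.
move=> idG MOG G1; have [GO _ GD GM] := idG.
have [|nG] := EM (forall x, G x -> MO x); first by left.
right; have /existsNP [x /not_implyP [Gx nMOx]] := nG.
have [c [d ex]] := hw (GO _ Gx); move: Gx nMOx; rewrite ex => Gx nMOx.
have [Md|/(local_unit hM) [z dz]] := EM (M d).
  exfalso; apply: nMOx; exists c, d; split=> //.
  apply: (proper_contract idG G1); rewrite -(addrK (f d * w) (f c)).
  apply: (submodB OR (ideal_in_submod idG)) => //.
  by apply: MOG; apply: ext_mul.
exists (- (z * c)); have -> : w - f (- (z * c)) = f z * (f c + f d * w).
  have fzd : f z * f d = 1 by rewrite -rmorphM mulrC dz rmorph1.
  by rewrite -[w in LHS]mul1r -fzd; ring.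
exact: GM.
Qed.

Lemma proper_mem G c x : ideal_in O G -> ~ G 1 -> G (w - f c) -> G x ->
  exists m d, M m /\ x = f m + f d * (w - f c).
Proof.
move=> idG G1 Gc Gx; have [GO _ GD GM] := idG.
have [a [d ex]] := hw (GO _ Gx); exists (a + d * c), d.
have e : x = f (a + d * c) + f d * (w - f c) by rewrite ex rmorphD rmorphM; ring.
split=> //; apply: (proper_contract idG G1).
have -> : f (a + d * c) = x - f d * (w - f c) by rewrite {1}e addrK.
by apply: (submodB OR (ideal_in_submod idG)) => //; apply: GM.
Qed.

(** If all three were proper, each of them plus MO would contain some w - c, where c is a root of
    X^2 - beta X - alpha modulo M. Comaximality makes the three roots distinct, too many for a
    quadratic over a field. *)
Lemma three_comaximal A B C :
    ideal_in O A -> ideal_in O B -> ideal_in O C ->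
    (exists a b, [/\ A a, B b & 1 = a + b]) ->
    (exists a c, [/\ A a, C c & 1 = a + c]) ->
    (exists b c, [/\ B b, C c & 1 = b + c]) ->
  [\/ A 1, B 1 | C 1].
Proof.
pose add X x := exists a y, [/\ X a, MO y & x = a + y].
have [MOO MO0 MOD MOM] := MO_ideal.
have [alpha [beta ew]] := basis_sqr.
have shrink X x : X x -> add X x by move=> Xx; exists x, 0; rewrite addr0.
have MO_in X x : ideal_in O X -> MO x -> add X x.
  by move=> [_ X0 _ _] MOx; exists 0, x; rewrite add0r.
have linear X Y : ideal_in O X -> ideal_in O Y -> ~ X 1 -> ~ Y 1 ->
    (exists a b, [/\ X a, Y b & 1 = a + b]) -> exists c, add X (w - f c).
  move=> idX idY X1 Y1 [a [b [Xa Yb e]]].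
  have [|XMO|//] := properE (add_ext idX) _ (add_ext_proper idX X1).
    by move=> x; apply: MO_in.
  exfalso; apply: (add_ext_proper idY Y1); exists b, a.
  by split=> //; [apply: XMO; apply: shrink|rewrite addrC].
have root X c : ideal_in O X -> ~ X 1 -> add X (w - f c) ->
    M (c * c - beta * c - alpha).
  move=> idX X1 Xc; apply: (proper_contract (add_ext idX) (add_ext_proper idX X1)).
  have -> : f (c * c - beta * c - alpha) = (f beta - f c - w) * (w - f c).
    rewrite !(rmorphB, rmorphM).
    transitivity (f c * f c - f beta * f c + f beta * w - (f alpha + f beta * w)).
      by ring.
    by rewrite -ew; ring.
  have [_ _ _] := add_ext idX; apply=> //.
  have [_ OB _] := OR; exact: OB _ _ (OB _ _ (Of beta) (Of c)) Ow.
have distinct X Y c d : ideal_in O X -> ideal_in O Y -> ~ X 1 -> ~ Y 1 ->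
    (exists a b, [/\ X a, Y b & 1 = a + b]) ->
    add X (w - f c) -> add Y (w - f d) -> ~ M (c - d).
  move=> idX idY X1 Y1 [a [b [Xa Yb e]]] Xc Yd Mcd.
  have [m [r [Mm eb]]] := proper_mem (add_ext idY) (add_ext_proper idY Y1) Yd (shrink _ _ Yb).
  apply: (add_ext_proper idX X1); have [_ _ XD XM] := add_ext idX.
  have -> : 1 = (a + f m) + f r * ((w - f c) + f (c - d)).
    by rewrite e eb rmorphB; ring.
  have XMO x : M x -> add X (f x) by move=> /(ext_f idM); apply: MO_in.
  apply: (XD); first by apply: XD; [apply: shrink|apply: XMO].
  by apply: XM => //; apply: XD => //; apply: XMO.
move=> idA idB idC AB AC BC; apply: contrapT => no.
have [A1 B1 C1] : [/\ ~ A 1, ~ B 1 & ~ C 1].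
  by split=> ?; apply: no; [apply: Or31|apply: Or32|apply: Or33].
have sym X Y : (exists a b, [/\ X a, Y b & 1 = a + b :> Q]) ->
    exists a b, [/\ Y a, X b & 1 = a + b].
  by move=> [a [b [Xa Yb e]]]; exists b, a; rewrite addrC.
have [a Aa] := linear A B idA idB A1 B1 AB.
have [b Bb] := linear B C idB idC B1 C1 BC.
have [c Cc] := linear C A idC idA C1 A1 (sym _ _ AC).
have Ma := root _ _ idA A1 Aa; have Mb := root _ _ idB B1 Bb.
have Mc := root _ _ idC C1 Cc.
have nab := distinct _ _ _ _ idA idB A1 B1 AB Aa Bb.
have nac := distinct _ _ _ _ idA idC A1 C1 AC Aa Cc.
have nbc := distinct _ _ _ _ idB idC B1 C1 BC Bb Cc.
have MB := submodB (@subring_true R) (ideal_in_submod idM).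
(* Two distinct roots sum to beta modulo M; the pairs (a, b) and (a, c) then force b = c modulo
   M. *)
have other x y : M (x * x - beta * x - alpha) -> M (y * y - beta * y - alpha) ->
    ~ M (x - y) -> M (x + y - beta).
  move=> Mx My nxy; have [_ _ MP] := local_prime hM; have [|//|//] := MP (x - y) (x + y - beta).
  have -> : (x - y) * (x + y - beta) =
    (x * x - beta * x - alpha) - (y * y - beta * y - alpha) by ring.
  exact: MB.
apply: nbc; have -> : b - c = (a + b - beta) - (a + c - beta) by ring.
by apply: MB; apply: other.
Qed.

End TwoGenerated.

(** * Idempotents and ideals in dimension one *)

Section DimensionOne.
Variables (R : comNzRingType) (Q : comUnitRingType) (f : {rmorphism R -> Q}).
Variables (M : R -> Prop) (s : R).
Hypotheses (hQ : total_quotient f) (hM : is_unique_maximal M).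
Hypotheses (hdim : krull_dim_one R) (Ms : M s) (rs : nonzerodivisor s).
Let O := int_closure f.
Let T (_ : R) := True.
Let idM := local_ideal hM.
Let OR := int_closure_subring f.
Let Of r : O (f r) := int_closure_f f r.
Let us := tq_unit hQ rs.

Lemma regular_dvd_power r b : nonzerodivisor r -> M b ->
  exists n x, b ^+ n = r * x.
Proof.
move=> rr Mb; have [Mr|/(local_unit hM) [y ry]] := EM (M r); last first.
  by exists 0%N, y.
have [n [m [x e]]] := dim_one_boundary hM hdim Mr Mb.
exists m, x; apply/eqP; rewrite -subr_eq0; apply/eqP.
exact: (nonzerodivisorX (n := n) rr).
Qed.

(** Every regular t divides a power of s, so Q is R with s inverted. *)
Lemma clear_denom q : exists n, frange f (f s ^+ n * q).
Proof.
have [a [t [rt eq]]] := tq_denom hQ q.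
have [n [x ex]] := regular_dvd_power rt Ms.
exists n, (x * a); rewrite -rmorphXn ex !rmorphM -eq; ring.
Qed.

Lemma regular_prime P : prime_ideal P -> regular_ideal P -> forall m, M m -> P m.
Proof.
move=> prP [r [Pr rr]] m Mm; have [n [x e]] := regular_dvd_power rr Mm.
apply: (prime_Xn (n := n) prP); rewrite e mulrC.
by have [[_ _ _ PM] _ _] := prP; apply: PM.
Qed.

(** Otherwise Cohen's argument gives a prime above I that is not finitely generated; as it contains
    a regular element, it is M. *)
Lemma regular_fg g I : gens T M g -> ideal I -> regular_ideal I ->
  exists h, gens T I h.
Proof.
move=> Mg idI [r [Ir rr]]; apply: contrapT => nfg.
have [P [prP IP nfgP]] := max_nonfg_prime idI nfg.
have [idP P1 _] := prP; apply: nfgP; exists g.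
have MP : forall m, M m -> P m by apply: regular_prime => //; exists r; split; first exact: IP.
have [Mg' spg] := Mg.
by split=> [a /Mg' /MP//|x Px]; apply: spg; apply: (ideal_sub_local hM idP).
Qed.

(** The boundary relation makes a (s^m - a x) nilpotent, hence 0. In Q this reads a = a^2 u with u =
    x / s^m, and e = a u is idempotent. *)
Lemma zero_dim_idempotent a : reduced R ->
  exists (e : Q) u, [/\ e * e = e, f a = e * f a & e = f a * u].
Proof.
move=> red; have [Ma|/(local_unit hM) [y ay]] := EM (M a); last first.
  exists 1, (f y); split; rewrite ?mul1r //.
  by rewrite -rmorphM ay rmorph1.
have [n [m [x e]]] := dim_one_boundary hM hdim Ma Ms.
have {}e : a * s ^+ m = a * a * x.
  apply/eqP; rewrite -subr_eq0; apply/eqP; apply: (red _ n.+1).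
  have -> : a * s ^+ m - a * a * x = a * (s ^+ m - a * x) by ring.
  rewrite exprMn (exprSr a) (exprS (_ - _)).
  transitivity (a ^+ n * (s ^+ m - a * x) * a * (s ^+ m - a * x) ^+ n); first by ring.
  by rewrite e !mul0r.
have usm : f s ^+ m \is a GRing.unit by rewrite unitrX.
have fe : f a * f s ^+ m = f a * f a * f x by rewrite -rmorphXn -!rmorphM e.
have fa : f a = f a * (f x / f s ^+ m) * f a.
  transitivity (f a * f a * f x / f s ^+ m); last by ring.
  by rewrite -fe mulrK.
exists (f a * (f x / f s ^+ m)), (f x / f s ^+ m); split=> //.
by rewrite mulrA -fa.
Qed.

Section Basis.
Variable w : Q.
Hypotheses (Ow : O w) (hw : forall q, O q -> exists c d, q = f c + f d * w).

Lemma conductor : exists t, nonzerodivisor t /\ forall q, O q -> frange f (f t * q).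
Proof.
have [a [t [rt et]]] := tq_denom hQ w; exists t; split=> // q /hw [c [d ->]].
exists (t * c + d * a); rewrite rmorphD !rmorphM -et; ring.
Qed.

Lemma separated_reduced :
  (forall x, (forall i, (1 <= i)%N -> ideal_pow M i x) -> x = 0) -> reduced R.
Proof.
move=> sep x n xn0; apply: sep => i _.
have [t [rt tO]] := conductor.
have usi : f s ^+ i \is a GRing.unit by rewrite unitrX.
(* Nilpotents of Q are integral, so t times this quotient, which is x / s^i, lies in R. *)
have [|r er] := tO (f x / (f t * f s ^+ i)).
  apply: (@nilpotent_int_closure _ _ _ _ n).
  by rewrite exprMn -[f x ^+ n]rmorphXn xn0 rmorph0 mul0r.
have -> : x = r * s ^+ i.
  apply: (tq_inj hQ); rewrite rmorphM rmorphXn -er invrM ?(tq_unit hQ) //.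
  transitivity (f x * (f s ^+ i / f s ^+ i) * (f t / f t)); last by ring.
  by rewrite !divrr ?mulr1 ?(tq_unit hQ).
by have [_ _ _ PM] := ideal_pow_ideal hM i; apply: PM => //; apply: ideal_powX.
Qed.

(** The annihilators of the idempotents in O are pairwise comaximal, because e' kills e and 1 - e'
    kills e'; one of them contains 1. *)
Lemma orthogonal_idempotents (e1 e2 e3 : Q) :
    e1 * e1 = e1 -> e2 * e2 = e2 -> e3 * e3 = e3 ->
    e1 * e2 = 0 -> e1 * e3 = 0 -> e2 * e3 = 0 ->
  [\/ e1 = 0, e2 = 0 | e3 = 0].
Proof.
move=> i1 i2 i3 e12 e13 e23; have [O1 OB OM] := OR.
pose A e x := O x /\ e * x = 0.
have idA e : ideal_in O (A e).
  split; first by move=> x [].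
  - by split; [exact: subring0 OR|rewrite mulr0].
  - move=> x y [Ox ex] [Oy ey]; split; first exact: subringD OR Ox Oy.
    by rewrite mulrDr ex ey addr0.
  - by move=> c x Oc [Ox ex]; split; [exact: OM|rewrite mulrCA ex mulr0].
have comax e e' : e' * e' = e' -> e * e' = 0 ->
    exists a b, [/\ A e a, A e' b & 1 = a + b].
  move=> i' ee'; have Oe' := idempotent_int_closure f i'.
  exists e', (1 - e'); split; [by split| |by rewrite addrC subrK].
  by split; [exact: OB|rewrite mulrBr mulr1 i' subrr].
have [[_ <-]|[_ <-]|[_ <-]] := three_comaximal hM Ow hw (idA e1) (idA e2) (idA e3)
    (comax _ _ i2 e12) (comax _ _ i3 e13) (comax _ _ i3 e23); rewrite mulr1.
- exact: Or31.
- exact: Or32.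
- exact: Or33.
Qed.

(** Here e generates the extension of I to Q. It is 1 if I contains a power of s and 0 if I = 0.
    Otherwise any nonzero p in I yields e: if some x in I had x <> e x, with idempotent e', then
    among e, e'(1 - e), (1 - e)(1 - e') only the last could vanish, so p and x would generate Q and
    I would contain a power of s. *)
Lemma ideal_idempotent I : reduced R -> ideal I -> exists (e : Q) N v z,
  [/\ e * e = e, I v, f v = f s ^+ N * e, f z = f s ^+ N * (1 - e) &
      forall x, I x -> f x = e * f x].
Proof.
move=> red idI; have [_ I0 ID IM] := idI.
have [[N IN]|nI] := EM (exists N, I (s ^+ N)).
  exists 1, N, (s ^+ N), 0; split; rewrite ?rmorph0 ?rmorphXn ?subrr ?mulr0 ?mulr1 //.
  by move=> x _; rewrite mul1r.
have [[p [Ip p0]]|nz] := EM (exists p, I p /\ p <> 0); last first.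
  exists 0, 0%N, 0, 1; split; rewrite ?rmorph0 ?rmorph1 ?mulr0 //; first by ring.
  move=> x Ix; rewrite mul0r; suff -> : x = 0 by rewrite rmorph0.
  by apply: contrapT => nx; apply: nz; exists x.
have [e [u [ee ep eu]]] := zero_dim_idempotent p red.
have [N1 [c ec]] := clear_denom u.
have [N2 [z ez]] := clear_denom (1 - e).
have fv : f (s ^+ N2 * (c * p)) = f s ^+ (N1 + N2) * e.
  by rewrite !rmorphM rmorphXn -ec exprD eu; ring.
exists e, (N1 + N2)%N, (s ^+ N2 * (c * p)), (s ^+ N1 * z); split=> //.
- by apply: (IM) => //; apply: IM.
- by rewrite rmorphM rmorphXn -ez exprD mulrA.
move=> x Ix; have [e' [u' [ee' ex eu']]] := zero_dim_idempotent x red.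
apply: contrapT => ne.
have i1 : (1 - e) * (1 - e) = 1 - e.
  transitivity (1 - e - (e - e * e)); first by ring.
  by rewrite ee subrr subr0.
have i1' : (1 - e') * (1 - e') = 1 - e'.
  transitivity (1 - e' - (e' - e' * e')); first by ring.
  by rewrite ee' subrr subr0.
have o1 : e * (1 - e) = 0 by rewrite mulrBr mulr1 ee subrr.
have o1' : e' * (1 - e') = 0 by rewrite mulrBr mulr1 ee' subrr.
have [||||||e0|e0|e0] := @orthogonal_idempotents e (e' * (1 - e)) ((1 - e) * (1 - e')).
- by [].
- by rewrite mulrACA ee' i1.
- by rewrite mulrACA i1 i1'.
- by rewrite mulrCA o1 mulr0.
- by rewrite mulrA o1 mul0r.
- transitivity (e' * (1 - e') * ((1 - e) * (1 - e))); first by ring.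
  by rewrite o1' mul0r.
- apply: p0; apply: (tq_inj hQ); rewrite rmorph0 ep e0 mul0r //.
- apply: ne; apply/eqP; rewrite -subr_eq0; apply/eqP.
  transitivity ((1 - e) * f x); first by ring.
  by rewrite ex mulrA (mulrC (1 - e)) e0 mul0r.
have [N3 [c' ec']] := clear_denom (u' * (1 - e)).
have key : f x * u' * (1 - e) = 1 - e.
  rewrite -eu'; apply/eqP; rewrite -subr_eq0; apply/eqP.
  transitivity (- ((1 - e) * (1 - e'))); first by ring.
  by rewrite e0 oppr0.
apply: nI; exists (N3 + (N1 + N2))%N.
have -> : s ^+ (N3 + (N1 + N2)) =
    s ^+ N3 * (s ^+ N2 * (c * p)) + s ^+ (N1 + N2) * c' * x.
  apply: (tq_inj hQ); rewrite rmorphD [f (s ^+ N3 * _)]rmorphM fv.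
  rewrite !rmorphM !rmorphXn -ec' [f s ^+ (N3 + _)]exprD.
  set SN := f s ^+ (N1 + N2); set S3 := f s ^+ N3.
  transitivity (S3 * SN * (e + f x * u' * (1 - e))); last by ring.
  by rewrite key addrC subrK mulr1.
by apply: ID; do ?apply: (IM).
Qed.

(** Take I' = I + zR, which contains the regular element v + z = s^N. Multiplication by e kills z
    and fixes I, so it carries generators of I' to as many generators of I. *)
Lemma regular_replacement I : reduced R -> ideal I -> exists I',
  [/\ ideal I', regular_ideal I' &
      forall g, gens T I' g -> exists g', size g' = size g /\ gens T I g'].
Proof.
move=> red idI; have [_ I0 ID IM] := idI.
have [e [N [v [z [ee Iv fv fz eI]]]]] := ideal_idempotent red idI.
exists (fun x => exists p y, I p /\ x = p + z * y); split.
- exact: ideal_adjoin.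
- exists (v + z); split; first by exists v, 1; rewrite mulr1.
  apply: (tq_regular hQ); rewrite rmorphD fv fz -mulrDr addrC subrK mulr1.
  by rewrite unitrX.
move=> g [I'g spg].
have [g' [sg' I'g' eg']] : exists g', [/\ size g' = size g,
    forall a, a \in g' -> I a &
    forall x, span T g x -> exists y, span T g' y /\ f y = e * f x].
  elim: g I'g {spg} => [|a g IH] I'g.
    exists [::]; split=> // x ->; exists 0; split=> //.
    by rewrite rmorph0 mulr0.
  have [|g' [sg' Ig' eg']] := IH; first by move=> b bg; apply: I'g; rewrite inE bg orbT.
  have [p [y [Ip ea]]] := I'g _ (mem_head a g).
  exists (p :: g'); split; first by rewrite /= sg'.
    by move=> b; rewrite inE => /predU1P [->//|/Ig'].
  move=> x /= [c _ /eg' [y' [sy' ey']]]; exists (y' + c * p); split.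
    by exists c; rewrite ?addrK.
  rewrite rmorphD ey' rmorphB !rmorphM ea rmorphD rmorphM fz (eI p Ip).
  transitivity (e * f x - f c * f s ^+ N * f y * (e - e * e) +
     f c * f p * (e - e * e)); first by ring.
  by rewrite ee subrr !mulr0 subr0 addr0.
exists g'; split=> //; split=> // x Ix.
have /spg /eg' [y [sy]] : exists p y, I p /\ x = p + z * y by exists x, 0; split=> //; ring.
by rewrite -eI // => /(tq_inj hQ) <-.
Qed.

Lemma reduced_noetherian g : reduced R -> gens T M g -> noetherian R.
Proof.
move=> red Mg; apply/noetherian_gens => I idI.
have [I' [idI' rI' gI']] := regular_replacement red idI.
have [h /gI' [h' [_ Ih']]] := regular_fg Mg idI' rI'.
by exists h'.
Qed.

(** * Denominator ideals and extensions of regular ideals to O *)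

Section Noetherian.
Hypothesis noeth : noetherian R.

(** The denominator ideal (O : q) in O. *)
Definition den q u := O u /\ O (u * q).

Lemma den_ideal q : ideal_in O (den q).
Proof.
have [_ _ OM] := OR; split; first by move=> x [].
- by split; rewrite ?mul0r; apply: subring0 OR.
- by move=> x y [Ox Oxq] [Oy Oyq]; split; rewrite ?mulrDl; apply: subringD.
- by move=> c x Oc [Ox Oxq]; split; rewrite -?mulrA; apply: OM.
Qed.

(** The ideal contains s^n for some n, hence every y^k s^n. A conductor t then gives t s^n y^k in R
    for all k, and [almost_integral] applies. *)
Lemma den_multiplier q y : (forall u, den q u -> den q (y * u)) -> O y.
Proof.
move=> yD; have [n [r er]] := clear_denom q; have [t [rt tO]] := conductor.
have Dy k : den q (y ^+ k * f (s ^+ n)).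
  elim: k => [|k IH]; last by rewrite exprS -mulrA; apply: yD.
  by rewrite mul1r; split=> //; rewrite rmorphXn er.
apply: (almost_integral hQ noeth (d := t * s ^+ n)).
  by apply: nonzerodivisorM => //; apply: nonzerodivisorX.
move=> k; have [Ok _] := Dy k.
by have [r' er'] := tO _ Ok; exists r'; rewrite -er' rmorphM; ring.
Qed.

Let sO x := exists o, O o /\ x = f s * o.

Lemma sO_submod : submod O sO.
Proof.
have [_ _ OM] := OR; split.
- by exists 0; rewrite mulr0; split=> //; apply: subring0 OR.
- move=> _ _ [x [Ox ->]] [y [Oy ->]]; exists (x + y); rewrite mulrDr.
  by split=> //; apply: subringD OR Ox Oy.
- move=> c _ Oc [x [Ox ->]]; exists (c * x); rewrite mulrCA.
  by split=> //; apply: OM.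
Qed.

(** If no power of h is in sO, [socle] gives x in R with no x h^k in sO, while M x h^n lies in sO
    for some n. Then x h^(n+1) g1 g2 = (h g1 g2)(x h^n) is in sO for all g1, g2 in G, and using
    [faith] twice puts x h^(n+1) in sO. *)
Lemma faithful_nilpotent G h : O h ->
    (forall x, O x -> (forall g, G g -> sO (x * g)) -> sO x) ->
    (forall g, G g -> O g) ->
    (forall g1 g2, G g1 -> G g2 -> ext f w M (h * g1 * g2)) ->
  exists n, sO (h ^+ n).
Proof.
move=> Oh faith GO hG; have [O1 _ OM] := OR; have [s0 sD sM] := sO_submod.
have OX n : O (h ^+ n) by elim: n => [|n IH] //; rewrite exprS; apply: OM.
have [g [Mg spg]] := (noetherian_gens R).1 noeth _ idM.
pose E r := exists n, sO (f r * h ^+ n).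
suff [n] : E 1 by rewrite rmorph1 mul1r; exists n.
apply: contrapT => E1.
have [||x [nEx Ex]] := @socle R E g _ _ E1.
- by move=> r x [n En]; exists n; rewrite rmorphM -mulrA; apply: sM.
- move=> a /Mg /(regular_dvd_power rs) [n [x ex]]; exists n, 0%N, (f x).
  by rewrite ex rmorphM mulr1.
have [n En] : exists n, forall a, a \in g -> sO (f a * (f x * h ^+ n)).
  elim: g {Mg spg} Ex => [|a g IH] Ex; first by exists 0%N.
  have [|n Hn] := IH; first by move=> b bg; apply: Ex; rewrite inE bg orbT.
  have [k Hk] := Ex _ (mem_head a g).
  exists (k + n)%N => b; rewrite inE => /predU1P [->|/Hn Hb]; rewrite exprD.
    have -> : f a * (f x * (h ^+ k * h ^+ n)) = h ^+ n * (f (a * x) * h ^+ k).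
      by rewrite rmorphM; ring.
    exact: sM.
  have -> : f b * (f x * (h ^+ k * h ^+ n)) = h ^+ k * (f b * (f x * h ^+ n)) by ring.
  exact: sM.
have {}En m : M m -> sO (f m * (f x * h ^+ n)).
  move=> /spg; apply: (span_min (J := fun c => sO (f c * (f x * h ^+ n)))) => //.
  by apply: (@ideal_in_submod R T); apply: fractional_ideal; apply: submod_frange; split.
have {}En y : ext f w M y -> sO (y * (f x * h ^+ n)).
  move=> [m [m' [/En Hm /En Hm' ->]]]; rewrite mulrDl; apply: sD => //.
  by rewrite mulrAC mulrC; apply: sM.
apply: nEx; exists n.+1.
have Oxh : O (f x * h ^+ n.+1) := OM _ _ (Of x) (OX _).
apply: (faith) (Oxh) _ => g1 Gg1; apply: faith => [|g2 Gg2]; first exact: OM Oxh (GO _ Gg1).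
have -> : f x * h ^+ n.+1 * g1 * g2 = h * g1 * g2 * (f x * h ^+ n).
  by rewrite exprS; ring.
exact: En (hG _ _ Gg1 Gg2).
Qed.

(** Suppose that D + qD is proper, and let G be its sum with MO. Faithfulness of G modulo sO
    excludes that the products of two elements of G all lie in MO. So G contains some v = w - c with
    v^2 = a + b v and a in M. If b is in M, these products are in MO after all; if b is a unit, v -
    b kills G modulo MO, so it is nilpotent modulo sO, which puts a power of b in M. *)
Lemma den_invertible q : exists u v, [/\ den q u, den q v & 1 = u + v * q].
Proof.
apply: contrapT => no.
have [O1 OB OM] := OR; have [DO D0 DD DM] := den_ideal q.
have [MOO MO0 MOD MOM] := ext_ideal Ow hw idM.
pose G0 x := exists u v, [/\ den q u, den q v & x = u + v * q].
have idG0 : ideal_in O G0.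
  split.
  - by move=> _ [u [v [[Ou _] [_ Ov] ->]]]; apply: subringD OR Ou Ov.
  - by exists 0, 0; split=> //; ring.
  - move=> _ _ [u [v [Du Dv ->]]] [u' [v' [Du' Dv' ->]]].
    by exists (u + u'), (v + v'); split; [exact: DD|exact: DD|ring].
  - move=> c _ Oc [u [v [Du Dv ->]]].
    by exists (c * u), (c * v); split; [exact: DM|exact: DM|ring].
pose G x := exists a y, [/\ G0 a, ext f w M y & x = a + y].
have idG : ideal_in O G := add_ext hM Ow hw idG0.
have G1 : ~ G 1 := add_ext_proper hM Ow hw idG0 no.
have [GO _ GD GM] := idG.
have G0G x : G0 x -> G x by exists x, 0; rewrite addr0.
have MOG x : ext f w M x -> G x by exists 0, x; rewrite add0r; split=> //; case: idG0.
(* If xG is inside sO, then x / s maps D and qD into O, hence D into D, and is integral. *)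
have faith x : O x -> (forall g, G g -> sO (x * g)) -> sO x.
  move=> Ox xG; exists (x / f s); split; last by rewrite mulrC divrK.
  have xO g : G g -> O (x / f s * g).
    move=> /xG [o [Oo e]]; suff -> : x / f s * g = o by [].
    by rewrite mulrAC e (mulrC (f s)) mulrK.
  apply: (@den_multiplier q) => u Du; split; first apply: xO.
    by apply: G0G; exists u, 0; split=> //; ring.
  rewrite -mulrA; apply: xO; apply: G0G; exists 0, u; split=> //; ring.
have sOMO x : sO x -> ext f w M x by move=> [o [Oo ->]]; apply: ext_mul.
have no1 : ~ forall g1 g2, G g1 -> G g2 -> ext f w M (1 * g1 * g2).
  move=> /(faithful_nilpotent O1 faith GO) [n].
  by rewrite expr1n => /sOMO /MOG.
have [GMO|[c Gc]] := properE hM Ow hw idG MOG G1.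
  apply: no1 => g1 g2 /GMO Mg1 /GO Og2; rewrite mul1r mulrC.
  exact: MOM.
have [alpha [beta ew]] := basis_sqr Ow hw.
set v := w - f c in Gc.
pose a := alpha + beta * c - c * c; pose b := beta - (c + c).
have Ov : O v := OB _ _ Ow (Of c).
have ev : v * v = f a + f b * v.
  rewrite /a /b /v !(rmorphB, rmorphD, rmorphM).
  transitivity (w * w - (f c + f c) * w + f c * f c); first by ring.
  by rewrite ew; ring.
have Ma : M a.
  apply: (proper_contract hM idG G1).
  have -> : f a = (v - f b) * v by rewrite mulrBl ev; ring.
  exact: GM _ _ (OB _ _ Ov (Of b)) Gc.
have mem g : G g -> exists m d, M m /\ g = f m + f d * v.
  by move=> Gg; apply: (proper_mem hM hw idG G1 Gc Gg).
have MOMl m x : M m -> O x -> ext f w M (f m * x) by apply: ext_mul.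
have [Mb|nMb] := EM (M b).
  apply: no1 => g1 g2 /mem [m [d [Mm ->]]] Gg2.
  have [m' [d' [Mm' e2]]] := mem _ Gg2; rewrite mul1r mulrDl.
  apply: (MOD); first by apply: MOMl => //; apply: GO.
  have -> : f d * v * g2 = f m' * (f d * v) + f d * f d' * (v * v) by rewrite e2; ring.
  rewrite ev; apply: (MOD); first exact: MOMl Mm' (OM _ _ (Of d) Ov).
  apply: (MOM); first exact: OM _ _ (Of d) (Of d').
  apply: (MOD); last exact: MOMl Mb Ov.
  exact: ext_f.
have Oh : O (v - f b) := OB _ _ Ov (Of b).
have [g1 g2 Gg1 /GO Og2|n] := faithful_nilpotent Oh faith GO.
  have [m [d [Mm ->]]] := mem _ Gg1.
  rewrite mulrC; apply: MOM => //.
  have -> : (v - f b) * (f m + f d * v) = f m * (v - f b) + f d * (v * v - f b * v).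
    by ring.
  rewrite ev addrK; apply: (MOD); first exact: MOMl Mm Oh.
  by rewrite mulrC; apply: MOMl Ma (Of d).
move=> /sOMO /MOG Gh; apply: nMb.
have [o [Oo eo]] : exists o, O o /\ (v - f b) ^+ n = f ((- b) ^+ n) + o * v.
  elim: n {Gh} => [|n [o [Oo eo]]].
    by exists 0; rewrite !expr0 rmorph1 mul0r addr0; split=> //; apply: subring0 OR.
  exists ((v - f b) * o + f ((- b) ^+ n)); split.
    exact: subringD OR (OM _ _ Oh Oo) (Of _).
  rewrite exprS eo (exprS (- b)) rmorphM rmorphN; ring.
have : M ((- b) ^+ n).
  apply: (proper_contract hM idG G1).
  have -> : f ((- b) ^+ n) = (v - f b) ^+ n - o * v by rewrite eo addrK.
  by apply: (submodB OR (ideal_in_submod idG)) => //; apply: GM.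
move=> /(prime_Xn (local_prime hM)).
by move=> /(submodN (@subring_true R) (ideal_in_submod idM)); rewrite opprK.
Qed.

(** The relation 1 = u + q v = (u - v) + (1 + q) v = q (v - u) + (1 + q) u makes D, qD and (1 + q)D
    pairwise comaximal; the one that contains 1 decides the case. *)
Lemma quotient_trichotomy q : [\/ O q, exists2 d, O d & q * d = 1 |
  exists2 d, O d & (1 + q) * d = 1].
Proof.
have [O1 OB OM] := OR; have [DO D0 DD DM] := den_ideal q.
have [u [v [Du Dv e]]] := den_invertible q.
pose A r x := exists2 u, den q u & x = r * u.
have idA r : (forall u, den q u -> O (r * u)) -> ideal_in O (A r).
  move=> rO; split.
  - by move=> _ [x Dx ->]; apply: rO.
  - by exists 0; rewrite ?mulr0.
  - by move=> _ _ [x Dx ->] [y Dy ->]; exists (x + y); rewrite ?mulrDr //; apply: DD.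
  - by move=> c _ Oc [x Dx ->]; exists (c * x); rewrite 1?mulrCA //; apply: DM.
have DB x y : den q x -> den q y -> den q (x - y).
  by apply: (submodB OR (ideal_in_submod (den_ideal q))).
have [|||||| [d [Od Odq] e1]|[d [Od _] e1]|[d [Od _] e1]] :=
    three_comaximal hM Ow hw (A := A 1) (B := A q) (C := A (1 + q)).
- by apply: idA => x [Ox _]; rewrite mul1r.
- by apply: idA => x [_]; rewrite mulrC.
- by apply: idA => x [Ox Oxq]; rewrite mulrDl mul1r (mulrC q); apply: subringD OR Ox Oxq.
- exists u, (q * v); split; [|by exists v|by rewrite {1}e; ring].
  by exists u; rewrite ?mul1r.
- exists (u - v), ((1 + q) * v); split; [|by exists v|by rewrite {1}e; ring].
  by exists (u - v); rewrite ?mul1r //; apply: DB.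
- exists (q * (v - u)), ((1 + q) * u); split; [|by exists u|by rewrite {1}e; ring].
  by exists (v - u) => //; apply: DB.
- by apply: Or31; move: Odq; rewrite -(mul1r d) -e1 mul1r.
- by apply: Or32; exists d.
- by apply: Or33; exists d.
Qed.

(** Induction on generators of I, starting from a regular r. If x serves so far and a comes next,
    the three cases for q = a / x say that x, a or x + a divides both in O. *)
Lemma regular_extension_principal I : ideal I -> regular_ideal I ->
  exists x, [/\ I x, nonzerodivisor x &
    forall y, I y -> exists2 o, O o & f y = f x * o].
Proof.
move=> idI [r [Ir rr]]; have [_ I0 ID IM] := idI; have [O1 OB OM] := OR.
have [g [Ig spg]] := (noetherian_gens R).1 noeth _ idI.
have [x [Ix rx xg]] : exists x, [/\ I x, nonzerodivisor x &
    forall y, y \in g -> exists2 o, O o & f y = f x * o].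
  elim: g Ig {spg} => [|a g IH] Ig; first by exists r.
  have [|x [Ix rx xg]] := IH; first by move=> b bg; apply: Ig; rewrite inE bg orbT.
  have Ia := Ig _ (mem_head a g); have ux := tq_unit hQ rx.
  have ea : f a = f x * (f a / f x) by rewrite mulrC divrK.
  set q := f a / f x in ea.
  have step x' d : I x' -> O d -> f x = f x' * d -> (exists2 o, O o & f a = f x' * o) ->
      exists x, [/\ I x, nonzerodivisor x &
        forall y, y \in a :: g -> exists2 o, O o & f y = f x * o].
    move=> Ix' Od ex ax'; exists x'; split=> //.
      by apply: (tq_regular hQ); move: ux; rewrite ex unitrM => /andP [].
    move=> y; rewrite inE => /predU1P [->//|/xg [o Oo ->]].
    by exists (d * o); [exact: OM|rewrite ex mulrA].
  case: (quotient_trichotomy q) => [Oq|[d Od qd]|[d Od qd]].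
  - by apply: (step x 1) => //; [rewrite mulr1|exists q].
  - apply: (step a d) => //; first by rewrite ea -mulrA qd mulr1.
    by exists 1; rewrite ?mulr1.
  - have ex : f (x + a) = f x * (1 + q) by rewrite rmorphD ea mulrDr mulr1.
    apply: (step (x + a) d) => //; first exact: ID.
      by rewrite ex -mulrA qd mulr1.
    exists (1 - d); first exact: OB.
    rewrite ex {1}ea -mulrA; congr (_ * _).
    by rewrite mulrBr qd mulr1; ring.
exists x; split=> // y /spg.
apply: (span_min (J := fun y => exists2 o, O o & f y = f x * o)) => //; split.
- by exists 0; rewrite ?rmorph0 ?mulr0 //; apply: subring0 OR.
- move=> y1 y2 [o1 O1' e1] [o2 O2' e2]; exists (o1 + o2); first exact: subringD OR O1' O2'.
  by rewrite rmorphD e1 e2 mulrDr.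
- move=> c y1 _ [o Oo e]; exists (f c * o); first exact: OM _ _ (Of c) Oo.
  by rewrite rmorphM e mulrCA.
Qed.

Lemma regular_two_generated I : ideal I -> regular_ideal I ->
  exists g, (size g <= 2)%N /\ gens T I g.
Proof.
move=> idI rI; have [_ I0 ID IM] := idI; have [_ OB OM] := OR.
have [x [Ix rx xI]] := regular_extension_principal idI rI.
have ux := tq_unit hQ rx.
(* I = x (R + L w), and L is principal modulo the conductor of w. *)
pose L b := exists2 i, I i & f i = f x * f b * w.
have idL : ideal L.
  split=> //; first by exists 0; rewrite // rmorph0; ring.
    move=> a b [i Ii ei] [j Ij ej]; exists (i + j); first exact: ID.
    by rewrite !rmorphD ei ej; ring.
  move=> c b _ [i Ii ei]; exists (c * i); first exact: IM.
  by rewrite !rmorphM ei; ring.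
have [|y [[z Iz ez] ry yL]] := regular_extension_principal idL.
  have [a [t [rt et]]] := tq_denom hQ w; exists t; split=> //.
  by exists (a * x); [exact: IM|rewrite rmorphM -et; ring].
exists [:: x; z]; split=> //; split.
  by move=> a; rewrite !inE => /orP [] /eqP ->.
move=> i Ii; have [o Oo ei] := xI i Ii; have [a [b eo]] := hw Oo.
have Lb : L b.
  exists (i - a * x); last by rewrite rmorphB rmorphM ei eo; ring.
  by apply: (submodB (@subring_true R) (ideal_in_submod idI)) => //; apply: IM.
have [o' Oo' eb] := yL b Lb.
(* With b = y o' and o' w = a' + b' w, the element i = x (a + b w) becomes (a + y a') x + b' z,
   where z = x y w. *)
have [a' [b' eo']] := hw (OM _ _ Oo' Ow).
exists (a + y * a') => //; exists b' => //.
apply: (tq_inj hQ); rewrite rmorph0 !(rmorphB, rmorphM) rmorphD rmorphM ei eo ez.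
have -> : f b * w = f y * (f a' + f b' * w) by rewrite -eo' eb mulrA.
by ring.
Qed.

End Noetherian.
End Basis.
End DimensionOne.

(** * Equivalence of the three conditions *)

Section Descent.
Variables (R : comNzRingType) (Q : comUnitRingType) (f : {rmorphism R -> Q}).
Hypothesis hQ : total_quotient f.
Let O := int_closure f.
Let T (_ : R) := True.
Let OR := int_closure_subring f.
Let Of r : O (f r) := int_closure_f f r.

Section QuadraticBasis.
Variable w : Q.
Hypotheses (Ow : O w) (hw : forall q, O q -> exists c d, q = f c + f d * w).

Lemma span_split g q : span O [seq f a | a <- g] q ->
  exists x y, [/\ span T g x, span T g y & q = f x + f y * w].
Proof.
elim: g q => [|a g IH] q /= => [->|[o Oo /IH [x [y [sx sy e]]]]].
  by exists 0, 0; split=> //; rewrite rmorph0; ring.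
have [c [d eo]] := hw Oo.
exists (x + c * a), (y + d * a); split.
- by exists c => //; rewrite addrK.
- by exists d => //; rewrite addrK.
- by rewrite -(subrK (o * f a) q) e eo; ring.
Qed.

(** Let h in I generate IO over O. For m in I, m w = x + y w with x and y in the R-span of h, so m -
    y lies in the O-ideal of those r in I with r w in I. That ideal is spanned over R by its
    O-generators [k1] and their multiples [k2] by w; hence h, [k1] and [k2] generate I. *)
Lemma eakin_nagata : noetherian_in O -> noetherian R.
Proof.
move=> noethO; apply/noetherian_gens => I idI; have [_ I0 ID IM] := idI.
have [O1 OB OM] := OR; have [alpha [beta ew]] := basis_sqr Ow hw.
have noeth J : ideal_in O J -> exists g, gens O J g.
  move=> idJ; have [g Jg] := noethO J idJ; exists g.
  exact/(generates_inP g OR (ideal_in_submod idJ)).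
have [g [Ig spg]] := noeth _ (ext_ideal Ow hw idI).
have [h [Ih sph]] : exists h, (forall a, a \in h -> I a) /\
    forall q, q \in g -> span O [seq f a | a <- h] q.
  elim: g Ig {spg} => [|q g IH] Ig; first by exists [::].
  have [|h [Ih sph]] := IH; first by move=> b bg; apply: Ig; rewrite inE bg orbT.
  have [a [b [Ia Ib eq]]] := Ig _ (mem_head q g).
  exists [:: a, b & h]; split.
    by move=> c; rewrite !inE => /or3P [/eqP ->|/eqP ->|/Ih].
  move=> p; rewrite inE => /predU1P [->|/sph]; last first.
    by apply: (span_sub OR) => c; rewrite !inE => ->; rewrite !orbT.
  have [_ sD sM] := span_submod [seq f a | a <- [:: a, b & h]] OR.
  rewrite eq; apply: sD; first by apply: (span_mem OR); rewrite inE eqxx.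
  by rewrite mulrC; apply: sM => //; apply: (span_mem OR); rewrite !inE eqxx orbT.
pose cI q := exists r r', [/\ I r, I r', q = f r & f r' = f r * w].
have idc : ideal_in O cI.
  split.
  - by move=> _ [r [_ [_ _ -> _]]].
  - by exists 0, 0; split; rewrite ?rmorph0 ?mul0r.
  - move=> _ _ [r [r' [Ir Ir' -> er]]] [u [u' [Iu Iu' -> eu]]].
    exists (r + u), (r' + u'); split; rewrite ?rmorphD ?er ?eu ?mulrDl //; exact: ID.
  - move=> o _ /hw [c [d ->]] [r [r' [Ir Ir' -> er]]].
    exists (c * r + d * r'), (c * r' + d * (alpha * r + beta * r')); split.
    + by apply: ID; apply: IM.
    + by apply: (ID); apply: (IM) => //; apply: (ID); apply: IM.
    + by rewrite rmorphD !rmorphM er; ring.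
    + rewrite !(rmorphD, rmorphM) er.
      transitivity (f c * f r * w + f d * f r * (f alpha + f beta * w)); first by ring.
      by rewrite -ew; ring.
have [k [ck spk]] := noeth _ idc.
have [k1 [k2 [ek Ik1 Ik2 k12]]] : exists k1 k2, [/\ k = [seq f a | a <- k1],
    forall a, a \in k1 -> I a, forall a, a \in k2 -> I a &
    forall y, span T k1 y -> exists y', span T k2 y' /\ f y' = f y * w].
  elim: k ck {spk} => [|q k IH] ck.
    exists [::], [::]; split=> // y ->; exists 0; split=> //.
    by rewrite rmorph0 mul0r.
  have [|k1 [k2 [-> Ik1 Ik2 k12]]] := IH; first by move=> b bg; apply: ck; rewrite inE bg orbT.
  have [r [r' [Ir Ir' -> er]]] := ck _ (mem_head q k).
  exists (r :: k1), (r' :: k2); split=> //.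
  - by move=> a; rewrite inE => /predU1P [->//|/Ik1].
  - by move=> a; rewrite inE => /predU1P [->//|/Ik2].
  move=> y /= [c _ /k12 [y' [sy' ey']]]; exists (y' + c * r'); split.
    by exists c; rewrite ?addrK.
  by rewrite rmorphD ey' rmorphB !rmorphM er; ring.
exists (h ++ k1 ++ k2); split.
  by move=> a; rewrite !mem_cat => /or3P [/Ih|/Ik1|/Ik2].
move=> m Im.
have /spg : ext f w I (f m * w) by exists 0, m; split=> //; rewrite rmorph0 add0r.
move=> /(span_min (span_submod _ OR) sph) /span_split [x [y [sx sy exy]]].
have IS := ideal_in_submod idI.
have Ix := span_min IS Ih sx; have Iy := span_min IS Ih sy.
have /spk : cI (f (m - y)).
  exists (m - y), x; split=> //; first exact: (submodB (@subring_true R) IS).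
  by rewrite rmorphB mulrBl exy addrK.
rewrite ek => /span_split [x1 [y1 [sx1 /k12 [z [sz ez]] e1]]].
have {e1} : m = y + (x1 + z).
  by apply: (tq_inj hQ); rewrite !rmorphD ez -e1 rmorphB addrC subrK.
move=> ->; have [_ sD _] := span_submod (h ++ k1 ++ k2) (@subring_true R).
apply: (sD); [|apply: sD].
- by apply: span_sub sy => // a; rewrite !mem_cat => ->.
- by apply: span_sub sx1 => // a; rewrite !mem_cat => ->; rewrite orbT.
- by apply: span_sub sz => // a; rewrite !mem_cat => ->; rewrite !orbT.
Qed.

End QuadraticBasis.

Lemma noetherian_int_closure t : noetherian R -> nonzerodivisor t ->
  (forall q, O q -> frange f (f t * q)) -> noetherian_in O.
Proof.
move=> /noetherian_gens noeth rt tO J idJ; have [JO _ _ _] := idJ.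
have JS := submod_frange (ideal_in_submod idJ).
have [g Jg] := noeth _ (fractional_ideal (f t)^-1 JS).
have [Jg' sp] := fractional_gens hQ rt (fun q Jq => tO q (JO q Jq)) Jg.
exists [seq f a / f t | a <- g].
apply/(generates_inP _ OR (ideal_in_submod idJ)); split=> // x /sp.
apply: span_min; first by apply: submod_frange; apply: span_submod OR.
by move=> a; apply: span_mem OR.
Qed.

Lemma noetherian_generalized_local (M : R -> Prop) s : krull_dim_one R ->
    is_unique_maximal M -> M s -> nonzerodivisor s -> noetherian R ->
  generalized_local M.
Proof.
move=> hdim hM Ms rs noeth; have idM := local_ideal hM.
have [g Mg] := (noetherian_gens R).1 noeth _ idM.
split=> //; first exact: noeth.
move=> x Mx; apply: (separated_powers hM noeth Ms rs) => k.
have [||l Ml] := @ideal_pow_sub R M (fun x => exists y, x = s ^+ k * y) g Mg.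
- split=> //; first by exists 0; rewrite mulr0.
    by move=> _ _ [y ->] [z ->]; exists (y + z); rewrite mulrDr.
  by move=> c _ _ [y ->]; exists (c * y); rewrite mulrCA.
- by move=> m Mm; apply: (regular_dvd_power hM hdim) => //; apply: nonzerodivisorX.
(* [Mx] covers positive exponents only; for l = 0 the power is the whole ring. *)
- by case: l Ml => [|l] Ml; apply: Ml => //; apply: Mx.
Qed.

End Descent.

Theorem theorem5p8 (R : comNzRingType) (Q : comUnitRingType)
    (f : {rmorphism R -> Q}) (M : R -> Prop)
    (hQ : total_quotient f) (hM : is_unique_maximal M)
    (hdim : krull_dim_one R) (hreg : regular_ideal M) :
  (bass_ring f <-> generalized_local M /\ rmodule_2gen f (int_closure f)) /\
  (generalized_local M /\ rmodule_2gen f (int_closure f) <->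
     noetherian_in (int_closure f) /\ rmodule_2gen f (int_closure f)).
Proof.
have [s [Ms rs]] := hreg.
have OS := int_closure_submod f.
have main : generalized_local M /\ rmodule_2gen f (int_closure f) ->
    bass_ring f /\ noetherian_in (int_closure f).
  move=> [[_ [g Mg] sep] O2]; have [w [Ow hw]] := int_closure_basis hM O2.
  have {Mg} /(generates_inP g (@subring_true R) (ideal_in_submod (local_ideal hM))) Mg := Mg.
  have red := separated_reduced hQ hM Ms rs hw sep.
  have noeth := reduced_noetherian hQ hM hdim Ms rs Ow hw red Mg.
  have [t [rt tO]] := conductor hQ hw.
  split; last exact: noetherian_int_closure noeth rt tO.
  split=> //; first by exists M.
    by have [h [_ Oh]] := O2; exists h.
  move=> I idI.
  have [I' [idI' rI' gI']] := regular_replacement hQ hM hdim Ms rs Ow hw red idI.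
  have [h [sh /gI' [h' [sh' Ih']]]] :=
    regular_two_generated hQ hM hdim Ms rs Ow hw noeth idI' rI'.
  exists h'; rewrite sh'; split=> //.
  exact/(generates_inP _ (@subring_true R) (ideal_in_submod idI)).
split; split.
- move=> [red noeth _ [g /(rmodule_generatesP _ OS) [Og spg]] two].
  split; first exact: noetherian_generalized_local hdim hM Ms rs noeth.
  (* t O is an ideal of R, so it has two generators; dividing them by t gives generators of O. *)
  have [t [rt tO]] := common_denom hQ g.
  have [h [sh]] := two _ (fractional_ideal (f t)^-1 OS).
  move=> /(generates_inP _ (@subring_true R) (ideal_in_submod (fractional_ideal _ OS))).
  move=> /(fractional_gens hQ rt (fun q Oq => tO q (spg q Oq))) Oh.
  by exists [seq f a / f t | a <- h]; rewrite size_map; split=> //; apply/rmodule_generatesP.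
- by case/main.
- by move=> h; split; [case: (main h)|case: h].
- move=> [noethO O2]; split=> //; have [w [Ow hw]] := int_closure_basis hM O2.
  exact: noetherian_generalized_local hdim hM Ms rs (eakin_nagata hQ Ow hw noethO).
Qed.
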